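(* Let $\mathcal{T}=\{S_1,\ldots,S_k\}$ be a tiling, where $S_\ell$ has side length $\delta_\ell$ and bottom-left corner $(x_\ell,y_\ell)$, and let $\mu$ be a permuton with $\mu(S_1\cup\cdots\cup S_k)=1$; let $\mu_\ell$ be the restriction of $\mu$ to $S_\ell$. Assume that each $\mu_\ell$ admits a piecewise continuous, strictly positive density $f_\ell$ on $S_\ell$ which is top-right continuous at $(x_\ell,y_\ell)$ (i.e. continuous there as a function on $S_\ell$) and bottom-left continuous at $(x_\ell+\delta_\ell,y_\ell+\delta_\ell)$ (i.e. continuous there as a function on $S_\ell$). Let $\mathcal{I}_n^\mu$ be the minimal inversion of $n$ i.i.d. points distributed according to $\mu$. Then, as $n\to\infty$: (i) if the set of splittings $D_{\mathcal{T}}$ is non-empty, then $n^{-1/2}\mathcal{I}_n^\mu$ converges in distribution to $$\mathrm{Rayleigh}\left(2,\ \sum_{\ell\in D_{\mathcal{T}}}\frac{f_\ell(x_\ell,y_\ell)+f_\ell(x_\ell+\delta_\ell,y_\ell+\delta_\ell)}{2}\right);$$ (ii) if $D_{\mathcal{T}}$ is empty, then $n^{-1}\mathcal{I}_n^\mu$ converges in distribution (and also in probability) to the constant $$M_{\mathcal{T}}=\min\left\{\sum_{m\in\mathrm{Inv}_{\sigma_{\mathcal{T}}}(\ell)}\delta_m:\ \ell\in[k]\right\}.$$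
   Context: A permuton is a probability measure on $[0,1]^2$ with uniform marginals. Minimal inversion: for i.i.d. points $(X_1,Y_1),\ldots,(X_n,Y_n)$ sampled from $\mu$, let $\mathrm{Inv}(i)=\{j:(X_i-X_j)(Y_i-Y_j)<0\}$ and $\mathcal{I}_n^\mu=\min\{|\mathrm{Inv}(i)|:1\le i\le n\}$. For a permutation $\sigma$ of $[k]$, $\mathrm{Inv}_\sigma(\ell)=\{m:(\ell-m)(\sigma(\ell)-\sigma(m))<0\}$. $\mathrm{Rayleigh}(a,b)$ is the law of a random variable $R$ on $[0,\infty)$ with $\mathbb{P}(R>t)=e^{-bt^a}$ for all $t\ge0$. Tiling: a finite family $\mathcal{T}=\{S_1,\ldots,S_k\}$ of closed axis-parallel squares in $[0,1]^2$ with non-empty interior such that the horizontal side intervals cover $[0,1]$ and have pairwise disjoint interiors, and likewise for the vertical side intervals. The squares are ordered so that $x_1<\cdots<x_k$. The permutation $\sigma_{\mathcal{T}}$ of $[k]$ is the one with $\sigma_{\mathcal{T}}(\ell)<\sigma_{\mathcal{T}}(m)\iff y_\ell<y_m$. The set of splittings is $D_{\mathcal{T}}=\{\ell\in[k]:\mathrm{Inv}_{\sigma_{\mathcal{T}}}(\ell)=\emptyset\}$. *)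

(* Defs.v *)
From HB Require Import structures.
From mathcomp Require Import all_boot all_order all_algebra perm.
From mathcomp Require Import all_classical all_reals all_analysis.
From mathcomp Require Import measurable_realfun.

Set Implicit Arguments.
Unset Strict Implicit.
Unset Printing Implicit Defensive.

Import Order.TTheory GRing.Theory Num.Theory.
Import numFieldNormedType.Exports.

Local Open Scope classical_set_scope.
Local Open Scope ring_scope.

Definition is_permuton (R : realType) (mu : probability (R * R)%type R) : Prop :=
  [/\ mu (`[0, 1] `*` `[0, 1]) = 1%E,
      forall A : set R, measurable A ->
        mu (A `*` [set: R]) = uniform_prob (@ltr01 R) A
    & forall A : set R, measurable A ->
        mu ([set: R] `*` A) = uniform_prob (@ltr01 R) A].

Definition point_inversions (R : realType) n (z : 'I_n -> R * R) (i : 'I_n) :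
    {set 'I_n} :=
  [set j | ((z i).1 - (z j).1) * ((z i).2 - (z j).2) < 0]%SET.

(* An inversion set has fewer than n elements, so the default value n does not
   affect the minimum as soon as n > 0. *)
Definition min_inversion (R : realType) n (z : 'I_n -> R * R) : nat :=
  \big[minn/n]_(i < n) #|point_inversions z i|.

Definition perm_inversions k (s : 'S_k) (l : 'I_k) : {set 'I_k} :=
  [set m : 'I_k | (l%:Z - m%:Z) * ((s l)%:Z - (s m)%:Z) < 0]%SET.

Record tiling (R : realType) (k : nat) := Tiling {
  tile_x : 'I_k -> R;
  tile_y : 'I_k -> R;
  tile_side : 'I_k -> R;
  tile_side_gt0 : forall l, 0 < tile_side l;
  tile_sub01 : forall l,
    `[tile_x l, tile_x l + tile_side l]%classic
      `*` `[tile_y l, tile_y l + tile_side l]%classic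
    `<=` `[0, 1]%classic `*` `[0, 1]%classic;
  tile_x_cover : `[0, 1]%classic `<=`
    \bigcup_l `[tile_x l, tile_x l + tile_side l]%classic;
  tile_y_cover : `[0, 1]%classic `<=`
    \bigcup_l `[tile_y l, tile_y l + tile_side l]%classic;
  tile_x_disj : trivIset [set: 'I_k]
    (fun l => `[tile_x l, tile_x l + tile_side l]%classic°);
  tile_y_disj : trivIset [set: 'I_k]
    (fun l => `[tile_y l, tile_y l + tile_side l]%classic°);
  tile_x_lt : forall l m : 'I_k, (l < m)%N -> tile_x l < tile_x m
}.

Section Tiling.
Context (R : realType) (k : nat) (t : tiling R k).

Definition tile (l : 'I_k) : set (R * R) :=
  `[tile_x t l, tile_x t l + tile_side t l]%classic
    `*` `[tile_y t l, tile_y t l + tile_side t l]%classic.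

Definition bottom_left (l : 'I_k) : R * R := (tile_x t l, tile_y t l).

Definition top_right (l : 'I_k) : R * R :=
  (tile_x t l + tile_side t l, tile_y t l + tile_side t l).

Lemma tile_y_inj : injective (tile_y t).
Proof.
move=> l m ylm; apply: (@tile_y_disj _ _ t l m I I).
have dl := tile_side_gt0 t l; have dm := tile_side_gt0 t m.
pose d := Num.min (tile_side t l) (tile_side t m).
have d0 : 0 < d by rewrite /d lt_min dl dm.
have dhalf : d / 2 < d by rewrite ltr_pdivrMr// ltr_pMr// ltr1n.
exists (tile_y t l + d / 2); rewrite !interior_itv; split;
  rewrite /= in_itv/= -?ylm ltrDl divr_gt0//= ltrD2l (lt_le_trans dhalf)//;
  by rewrite ge_min lexx ?orbT.
Qed.

Definition tile_rank_nat (l : 'I_k) : nat :=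
  #|[set m | tile_y t m < tile_y t l]%SET|.

Lemma tile_rank_subproof l : (tile_rank_nat l < k)%N.
Proof.
rewrite -[ltnRHS]card_ord -cardsT; apply/proper_card/properP.
by split; [exact: finset.subsetT | exists l; rewrite ?inE// ltxx].
Qed.

Definition tile_rank (l : 'I_k) : 'I_k := Ordinal (tile_rank_subproof l).

Lemma tile_rank_lt l m : tile_y t l < tile_y t m -> (tile_rank l < tile_rank m)%N.
Proof.
move=> lm; apply/proper_card/properP; split.
  by apply/fintype.subsetP => i; rewrite !inE => /lt_trans; exact.
by exists l; rewrite inE// ltxx.
Qed.

Lemma tile_rank_inj : injective tile_rank.
Proof.
move=> l m lm; apply: tile_y_inj; apply/eqP; rewrite eq_le !leNgt.
by apply/andP; split; apply/negP => /tile_rank_lt; rewrite lm ltnn.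
Qed.

Definition tiling_perm : 'S_k := perm tile_rank_inj.

Lemma tiling_permP l m :
  (tiling_perm l < tiling_perm m)%N = (tile_y t l < tile_y t m).
Proof.
rewrite !permE; apply/idP/idP => [|/tile_rank_lt//].
case: ltgtP => // [/tile_rank_lt ml /(ltn_trans ml)|/tile_y_inj ->];
  by rewrite ltnn.
Qed.

Definition splittings : {set 'I_k} :=
  [set l | perm_inversions tiling_perm l == finset.set0]%SET.

(* The side lengths add up to 1, so the default value 1 does not affect the
   minimum. *)
Definition min_tiling_inversion : R :=
  \big[Num.min/1]_(l < k) \sum_(m in perm_inversions tiling_perm l) tile_side t m.

End Tiling.

Section Densities.
Context (R : realType).
Local Notation lebesgue2 := (@lebesgue_measure R \x @lebesgue_measure R)%E.

Definition is_density_on (mu : probability (R * R)%type R) (S : set (R * R))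
    (f : R * R -> R) : Prop :=
  measurable_fun S f /\
  forall A : set (R * R), measurable A ->
    mu (A `&` S) = (\int[lebesgue2]_(z in A `&` S) (f z)%:E)%E.

(* The pieces are open and exhaust [S] up to a null set: nothing is required of
   the values on the lines or curves separating the pieces. *)
Definition piecewise_continuous_on (S : set (R * R)) (f : R * R -> R) : Prop :=
  exists (N : nat) (U : 'I_N -> set (R * R)),
    [/\ forall i, open (U i) /\ U i `<=` S,
        trivIset [set: 'I_N] U,
        lebesgue2 (S `\` \bigcup_i U i) = 0%E
      & forall i, {in U i, continuous f}].

Definition continuous_at_within (S : set (R * R)) (c : R * R)
    (f : R * R -> R) : Prop :=
  f z @[z --> within S (nbhs c)] --> f c.

End Densities.

Section Independence.
Context d (T : measurableType d) d' (T' : measurableType d') (R : realType)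
  (P : probability T R).

Definition independent_RVs (I : finType) (X : I -> {RV P >-> T'}) : Prop :=
  forall (J : {set I}) (B : I -> set T'), (forall i, measurable (B i)) ->
    P (\bigcap_(i in [set` J]) (X i @^-1` B i)) =
    (\prod_(i in J) P (X i @^-1` B i))%E.

Definition iid (I : finType) (X : I -> {RV P >-> T'}) (mu : probability T' R) :
    Prop :=
  independent_RVs X /\
  forall i (B : set T'), measurable B -> distribution P (X i) B = mu B.

End Independence.
Arguments independent_RVs {d T d' T' R} P {I} X.
Arguments iid {d T d' T' R} P {I} X mu.

Section ScaledMinInversion.
Context d (T : measurableType d) (R : realType) (P : probability T R) (n : nat).

Definition scaled_min_inversion (c : R) (Z : 'I_n -> {RV P >-> (R * R)%type}) :
    T -> R :=
  fun w => c * (min_inversion (fun i => Z i w))%:R.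

Lemma scaled_min_inversionE (c : R) (Z : 'I_n -> {RV P >-> (R * R)%type}) w :
  scaled_min_inversion c Z w =
  c * \big[Num.min/n%:R]_(i < n) \sum_(j < n) \1_[set r : R | r < 0]
    (((Z i w).1 - (Z j w).1) * ((Z i w).2 - (Z j w).2)).
Proof.
rewrite /scaled_min_inversion /min_inversion.
rewrite (big_morph _ (natr_min _) (erefl n%:R)); congr (_ * _).
apply: eq_bigr => i _; rewrite -sum1_card natr_sum big_mkcond/=.
apply: eq_bigr => j _; rewrite inE indicE.
by case: ifPn => [h|/negP h]; [rewrite mem_set|rewrite memNset].
Qed.

Lemma measurable_scaled_min_inversion (c : R)
    (Z : 'I_n -> {RV P >-> (R * R)%type}) :
  measurable_fun [set: T] (scaled_min_inversion c Z).
Proof.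
rewrite (funext (scaled_min_inversionE c Z)).
apply: measurable_funM; first exact: measurable_cst.
move: {1}(index_enum _) => r; elim: r => [|i s IHs].
  by under eq_fun do rewrite big_nil; exact: measurable_cst.
under eq_fun do rewrite big_cons.
apply: measurable_minr => //; apply: measurable_sum.
move=> j.
apply: measurableT_comp.
  by apply: measurable_indic; rewrite -set_itvNyo; exact: measurable_itv.
have m1 l : measurable_fun [set: T] (fst \o Z l).
  exact: measurableT_comp measurable_fst (measurable_funPT _).
have m2 l : measurable_fun [set: T] (snd \o Z l).
  exact: measurableT_comp measurable_snd (measurable_funPT _).
by apply: measurable_funM; apply: measurable_funB;
  [exact: m1|exact: m1|exact: m2|exact: m2].
Qed.

HB.instance Definition _ (c : R) (Z : 'I_n -> {RV P >-> (R * R)%type}) :=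
  isMeasurableFun.Build _ _ _ _ (scaled_min_inversion c Z)
    (measurable_scaled_min_inversion c Z).

End ScaledMinInversion.

Section Convergence.
Context (R : realType) (d : nat -> measure_display)
  (T : forall n, measurableType (d n)) (P : forall n, probability (T n) R)
  (X : forall n, {RV P n >-> R}).

Definition cvg_in_distribution (nu : probability R R) : Prop :=
  forall r : R, {for r, continuous (fun s : R => nu `]-oo, s]%classic)} ->
    cdf (X n) r @[n --> \oo] --> nu `]-oo, r]%classic.

Definition cvg_in_probability (c : R) : Prop :=
  forall e : R, 0 < e ->
    P n [set w | e < `|X n w - c|] @[n --> \oo] --> 0%E.

End Convergence.
Arguments cvg_in_distribution {R d T} P X nu.
Arguments cvg_in_probability {R d T} P X c.

Definition is_rayleigh (R : realType) (nu : probability R R) (a b : R) : Prop :=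
  nu `[0, +oo[%classic = 1%E /\
  forall t : R, 0 <= t -> nu `]t, +oo[%classic = (expR (- (b * t `^ a)))%:E.

(* Main.v *)
(* Write p(z) for the mu-mass of the points inverted with z. Given z, the number
   of sample points inverted with z is close to n p(z), uniformly in z: cover
   the unit square by a grid of mesh O(1/n); inside a cell the set of points
   inverted with z is trapped between two fixed sets whose masses differ by at
   most two mesh sizes (uniform marginals), so a Chernoff bound for each of the
   O(n^2) cells and a union bound suffice. No conditioning on a sample point is
   needed, and the error is exponentially small in sqrt n.

   Hence the minimal inversion is governed by the minimum of p over the sample.
   On a square with inversions in the tiling permutation, p is at least the
   total side length of the inverted squares, and this value is approached at
   the corners; this gives (ii). On a splitting square p is bounded below away
   from the bottom-left and top-right corners, and near such a corner p(z) is
   equivalent to the l1-distance of z to the corner. So the event that the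
   minimal inversion exceeds s sqrt n is asymptotically the event that no point
   falls in the corner triangles of size s / sqrt n. They have total mass
   equivalent to b s^2 / n, where b is the Rayleigh parameter, and the
   probability of that event is (1 - b s^2 / n)^n, up to o(1); this gives (i). *)

Require Import Defs.
From HB Require Import structures.
From mathcomp Require Import all_boot all_order all_algebra perm.
From mathcomp Require Import all_classical all_reals all_analysis.
From mathcomp Require Import measurable_realfun ring lra.

Set Implicit Arguments.
Unset Strict Implicit.
Unset Printing Implicit Defensive.

Import Order.TTheory GRing.Theory Num.Theory.
Import numFieldNormedType.Exports.

Local Open Scope classical_set_scope.
Local Open Scope ring_scope.

(** * Masses of sets under a probability *)

Section Mass.
Context d (T : measurableType d) (R : realType) (P : probability T R).
Implicit Types A B : set T.

(** Real-valued, so that estimates between probabilities fall to linear and nonlinear arithmetic. *)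
Definition mass A : R := fine (P A).

Lemma massE A : measurable A -> P A = (mass A)%:E.
Proof. by move=> mA; rewrite fineK// fin_num_measure. Qed.

Lemma mass_ge0 A : 0 <= mass A.
Proof. exact/fine_ge0. Qed.

Lemma le_mass A B : measurable A -> measurable B -> A `<=` B ->
  mass A <= mass B.
Proof.
by move=> mA mB AB; rewrite -lee_fin -!massE// le_measure// inE.
Qed.

Lemma mass_le1 A : measurable A -> mass A <= 1.
Proof. by move=> mA; rewrite -lee_fin -massE// probability_le1. Qed.

Lemma mass_setC A : measurable A -> mass (~` A) = 1 - mass A.
Proof.
move=> mA; apply: EFin_inj; rewrite -massE ?probability_setC//.
  by rewrite massE.
exact: measurableC.
Qed.

Lemma mass_le_sum (I : finType) (D : pred I) A (F : I -> set T) :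
  measurable A -> (forall i, D i -> measurable (F i)) ->
  (forall w, A w -> exists2 i, D i & F i w) ->
  mass A <= \sum_(i | D i) mass (F i).
Proof.
move=> mA mF AF; rewrite -lee_fin -massE//.
have AF' : A `<=` \bigcup_(i in [set` D]) F i.
  by move=> w /AF[i Di Fi]; exists i.
apply: (@le_trans _ _ (\sum_(i \in [set` D]) P (F i))%E).
  by apply: content_sub_fsum AF'.
rewrite fsbig_finite//.
rewrite -sumEFin.
rewrite (perm_big [seq i <- index_enum I | D i]).
  rewrite big_filter le_eqVlt; apply/orP; left; apply/eqP.
  by apply: eq_bigr => i Di; rewrite massE//; exact: mF.
apply: uniq_perm; rewrite ?finmap.fset_uniq ?filter_uniq ?index_enum_uniq//.
by move=> i; rewrite in_fset_set// mem_filter mem_index_enum andbT;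
  apply/idP/idP => [/set_mem//|/mem_set].
Qed.

Lemma sum_mass_disjoint (I : finType) (D : pred I) A (F : I -> set T) :
  (forall i, D i -> measurable (F i)) ->
  (forall i j w, D i -> D j -> F i w -> F j w -> i = j) ->
  (forall w, A w <-> exists2 i, D i & F i w) ->
  mass A = \sum_(i | D i) mass (F i).
Proof.
move=> mF dF AF.
have -> : A = \bigcup_(i in [set` D]) F i.
  apply/seteqP; split => w; first by move=> /AF[i Di Fi]; exists i.
  by move=> [i Di Fi]; apply/AF; exists i.
rewrite /mass measure_fin_bigcup//; last first.
  by move=> i j Di Dj [w [Fi Fj]]; exact: dF Fi Fj.
rewrite fsbig_finite//.
rewrite (perm_big [seq i <- index_enum I | D i]).
  rewrite big_filter.
  rewrite -sum_fine => [|i Di]; last by rewrite fin_num_measure//; exact: mF.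
  by [].
apply: uniq_perm; rewrite ?finmap.fset_uniq ?filter_uniq ?index_enum_uniq//.
by move=> i; rewrite in_fset_set// mem_filter mem_index_enum andbT;
  apply/idP/idP => [/set_mem//|/mem_set].
Qed.

Lemma mass_sum_le (I : finType) (D : pred I) A (F : I -> set T) :
  measurable A -> (forall i, D i -> measurable (F i)) ->
  (forall i j w, D i -> D j -> F i w -> F j w -> i = j) ->
  (forall i, D i -> F i `<=` A) ->
  \sum_(i | D i) mass (F i) <= mass A.
Proof.
move=> mA mF dF FA.
rewrite -(@sum_mass_disjoint _ D (\bigcup_(i in [set` D]) F i))//.
  apply: le_mass => //; first exact: fin_bigcup_measurable.
  by move=> w [i Di /FA]; exact.
Qed.

Lemma le_massU A B C : measurable A -> measurable B -> measurable C ->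
  A `<=` B `|` C -> mass A <= mass B + mass C.
Proof.
move=> mA mB mC ABC; rewrite -lee_fin EFinD -!massE//.
apply: le_trans (measureU2 P mB mC).
by rewrite le_measure// inE//; exact: measurableU.
Qed.

Lemma massU_le A B C : measurable A -> measurable B -> measurable C ->
  B `<=` A -> C `<=` A -> (forall w, B w -> C w -> False) ->
  mass B + mass C <= mass A.
Proof.
move=> mA mB mC BA CA BC; rewrite -lee_fin EFinD -!massE//.
rewrite -measureU//.
  by rewrite le_measure ?inE//; [exact: measurableU|move=> w [/BA|/CA]].
by apply/seteqP; split => // w [/BC h /h].
Qed.

End Mass.

(** * Permutons and inversion sets *)

Lemma mulBB_lt0 (F : realDomainType) (a b c d : F) :
  ((a - b) * (c - d) < 0) = (a < b) && (d < c) || (b < a) && (c < d).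
Proof.
case: (ltgtP a b) => [ab|ba|->]; last by rewrite subrr mul0r ltxx.
- by rewrite nmulr_rlt0 ?subr_lt0// subr_gt0 orbF.
- by rewrite pmulr_rlt0 ?subr_gt0// subr_lt0.
Qed.

Lemma uniform_prob01E (R : realType) (A : set R) : measurable A ->
  uniform_prob (@ltr01 R) A = lebesgue_measure (A `&` `[0, 1]).
Proof.
move=> mA; rewrite /uniform_prob integral_uniform_pdf.
under eq_integral => x.
  rewrite inE/= in_itv/= => -[_ x01].
  rewrite /uniform_pdf x01 subr0 invr1.
  over.
by rewrite integral_cst ?mul1e//; exact: measurableI.
Qed.

(** * Strips under a uniform marginal, for both coordinates at once through a projection [pr] *)

Section Strips.
Context (R : realType) (mu : probability (R * R)%type R) (pr : R * R -> R).
Hypothesis mpr : measurable_fun [set: R * R] pr.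
Hypothesis unif : forall A : set R, measurable A ->
  mu (pr @^-1` A) = uniform_prob (@ltr01 R) A.

Lemma measurable_strip (A : set R) : measurable A -> measurable (pr @^-1` A).
Proof. by move=> mA; rewrite -[_ @^-1` _]setTI; exact: mpr. Qed.

Lemma mass_strip_le (a b : R) : a <= b ->
  mass mu [set w | a <= pr w <= b] <= b - a.
Proof.
move=> ab; rewrite -lee_fin -massE; last first.
  by apply: (@measurable_strip `[a, b]).
rewrite (_ : [set w | _] = pr @^-1` `[a, b]); last first.
  by apply/seteqP; split => w /=; rewrite in_itv.
rewrite unif// uniform_prob01E//.
apply: (@le_trans _ _ (lebesgue_measure `[a, b])).
  by rewrite le_measure ?inE//; exact: measurableI.
rewrite lebesgue_measure_itv/=; case: ifPn => //.
by rewrite lee_fin subr_ge0.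
Qed.

Lemma mass_open_strip (a b : R) : 0 <= a -> a <= b -> b <= 1 ->
  mass mu [set w | a < pr w < b] = b - a.
Proof.
move=> a0 ab b1; apply: EFin_inj; rewrite -massE; last first.
  by apply: (@measurable_strip `]a, b[).
rewrite (_ : [set w | _] = pr @^-1` `]a, b[); last first.
  by apply/seteqP; split => w /=; rewrite in_itv.
rewrite unif// uniform_prob01E// setIidl.
  rewrite lebesgue_measure_itv/= lte_fin; case: ltP => // ba.
  by congr EFin; lra.
by move=> x /=; rewrite !in_itv/=; lra.
Qed.

Lemma mass_line (a : R) : mass mu [set w | pr w = a] = 0.
Proof.
apply/eqP; rewrite eq_le mass_ge0 andbT.
have := @mass_strip_le a a (lexx _); rewrite subrr.
congr (mass mu _ <= _); apply/seteqP; split => w /=; last by move=> ->; lra.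
by move=> ?; lra.
Qed.

End Strips.

(** * Inversion sets and their envelopes over a rectangle *)

Section Antidiagonal.
Context (R : realType) (mu : probability (R * R)%type R).
Hypothesis permu : is_permuton mu.

Lemma permuton_fst (A : set R) : measurable A ->
  mu (fst @^-1` A) = uniform_prob (@ltr01 R) A.
Proof.
move=> mA; have [_ h _] := permu; rewrite -h//; congr (mu _).
by apply/seteqP; split => w //= [].
Qed.

Lemma permuton_snd (A : set R) : measurable A ->
  mu (snd @^-1` A) = uniform_prob (@ltr01 R) A.
Proof.
move=> mA; have [_ _ h] := permu; rewrite -h//; congr (mu _).
by apply/seteqP; split => w //= [].
Qed.

(** For [x1 <= x2] and [y1 <= y2] these are the points inverted with every point of the rectangle
    [[x1, x2] x [y1, y2]]. With both pairs of arguments swapped, they are the points inverted with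
    at least one point of it. *)
Definition antidiag (x1 x2 y1 y2 : R) : set (R * R) :=
  [set w | w.1 < x1 /\ y2 < w.2] `|` [set w | x2 < w.1 /\ w.2 < y1].

Lemma measurable_lt_fst (a : R) : measurable [set w : R * R | w.1 < a].
Proof.
rewrite (_ : [set w | _] = fst @^-1` `]-oo, a[); first exact: measurable_strip.
by apply/seteqP; split => w /=; rewrite in_itv.
Qed.

Lemma measurable_gt_fst (a : R) : measurable [set w : R * R | a < w.1].
Proof.
rewrite (_ : [set w | _] = fst @^-1` `]a, +oo[); first exact: measurable_strip.
by apply/seteqP; split => w /=; rewrite in_itv/= andbT.
Qed.

Lemma measurable_lt_snd (a : R) : measurable [set w : R * R | w.2 < a].
Proof.
rewrite (_ : [set w | _] = snd @^-1` `]-oo, a[); first exact: measurable_strip.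
by apply/seteqP; split => w /=; rewrite in_itv.
Qed.

Lemma measurable_gt_snd (a : R) : measurable [set w : R * R | a < w.2].
Proof.
rewrite (_ : [set w | _] = snd @^-1` `]a, +oo[); first exact: measurable_strip.
by apply/seteqP; split => w /=; rewrite in_itv/= andbT.
Qed.

Lemma measurable_antidiag x1 x2 y1 y2 : measurable (antidiag x1 x2 y1 y2).
Proof.
by apply: measurableU; apply: measurableI;
  [exact: measurable_lt_fst|exact: measurable_gt_snd|
   exact: measurable_gt_fst|exact: measurable_lt_snd].
Qed.

Definition inverted (z : R * R) : set (R * R) := antidiag z.1 z.1 z.2 z.2.

Lemma invertedP (z w : R * R) :
  inverted z w <-> (z.1 - w.1) * (z.2 - w.2) < 0.
Proof.
rewrite mulBB_lt0; split.
  by case=> -[/= -> ->]; rewrite ?orbT.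
by case/orP => /andP[? ?]; [right|left].
Qed.

Lemma antidiag_inverted x1 x2 y1 y2 (z : R * R) :
  x1 <= z.1 <= x2 -> y1 <= z.2 <= y2 ->
  antidiag x1 x2 y1 y2 `<=` inverted z.
Proof.
by move=> /andP[? ?] /andP[? ?] w [] [/= ? ?]; [left|right]; split => /=; lra.
Qed.

Lemma inverted_antidiag x1 x2 y1 y2 (z : R * R) :
  x1 <= z.1 <= x2 -> y1 <= z.2 <= y2 ->
  inverted z `<=` antidiag x2 x1 y2 y1.
Proof.
by move=> /andP[? ?] /andP[? ?] w [] [/= ? ?]; [left|right]; split => /=; lra.
Qed.

(** A point in the larger set but not in the smaller one lies in the vertical or the horizontal
    strip through the rectangle, and a strip has mass at most its width. *)
Lemma mass_antidiag_le x1 x2 y1 y2 : x1 <= x2 -> y1 <= y2 ->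
  mass mu (antidiag x2 x1 y2 y1) <=
  mass mu (antidiag x1 x2 y1 y2) + ((x2 - x1) + (y2 - y1)).
Proof.
move=> x12 y12.
have m1 : measurable [set w : R * R | x1 <= w.1 <= x2].
  by apply: (measurable_strip measurable_fst (A := `[x1, x2])).
have m2 : measurable [set w : R * R | y1 <= w.2 <= y2].
  by apply: (measurable_strip measurable_snd (A := `[y1, y2])).
apply: le_trans (le_massU mu (measurable_antidiag _ _ _ _)
  (measurable_antidiag x1 x2 y1 y2) (measurableU _ _ m1 m2) _) _.
  move=> w; rewrite /antidiag/=.
  case: (ltP w.1 x1) => w1; case: (ltP x2 w.1) => w2;
  case: (ltP w.2 y1) => w3; case: (ltP y2 w.2) => w4; lra || (move=> _; tauto) || lra.
rewrite lerD2l; apply: le_trans (le_massU mu _ m1 m2 _) _ => //.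
  exact: measurableU.
apply: lerD; apply: mass_strip_le => //.
exact: permuton_fst. exact: permuton_snd.
Qed.

End Antidiagonal.

(** * Binomial tails *)

Section Hits.
Context d (T : measurableType d) d' (T' : measurableType d') (R : realType).
Context (P : probability T R) (mu : probability T' R).
Context (n : nat) (Z : 'I_n -> {RV P >-> T'}).
Hypothesis Z_iid : iid P Z mu.

Definition hits (B : set T') (w : T) : {set 'I_n} := [set j | Z j w \in B]%SET.

(** Written as an intersection over all indices, each with [B] or its complement, so that
    independence turns its mass into a product. *)
Let cell (B : set T') (J : {set 'I_n}) : set T :=
  \bigcap_(i in [set` [set: 'I_n]%SET])
    (Z i @^-1` (if i \in J then B else ~` B)).

Let cellP B J w : cell B J w <-> hits B w = J.
Proof.
split=> [h|<- i _ /=].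
  apply/setP => i; rewrite inE; have /= := h i; rewrite finset.in_setT.
  move=> /(_ isT); case: ifPn => iJ Bi; first exact/mem_set.
  by apply/negbTE; rewrite notin_setE.
by rewrite inE; case: ifPn => [/set_mem//|/negP h /mem_set].
Qed.

Let measurable_cell B J : measurable B -> measurable (cell B J).
Proof.
move=> mB; apply: fin_bigcap_measurable => // i _.
rewrite -[_ @^-1` _]setTI; apply: measurable_funPT => //.
by case: ifP => // _; exact: measurableC.
Qed.

Let mass_cell B J : measurable B ->
  mass P (cell B J) =
  \prod_(i < n) (if i \in J then mass mu B else 1 - mass mu B).
Proof.
move=> mB; apply: EFin_inj; rewrite -massE; last exact: measurable_cell.
have [ind dis] := Z_iid.
have mBi i : measurable (if i \in J then B else ~` B).
  by case: ifP => // _; exact: measurableC.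
rewrite /cell ind//.
transitivity (\prod_(i in [set: 'I_n]%SET)
    (if i \in J then mass mu B else 1 - mass mu B)%:E)%E.
  apply: eq_bigr => i _; rewrite -[LHS]/(distribution P (Z i) _) dis// massE//.
  by case: ifP => // _; rewrite mass_setC.
by rewrite prodEFin; apply: congr1; apply: eq_bigl => i; rewrite finset.in_setT.
Qed.

Lemma measurable_hits (B : set T') (phi : pred {set 'I_n}) : measurable B ->
  measurable [set w | phi (hits B w)].
Proof.
move=> mB; rewrite (_ : [set w | _] = \bigcup_(J in [set` phi]) cell B J).
  by apply: fin_bigcup_measurable => // J _; exact: measurable_cell.
apply/seteqP; split => w /=; first by move=> h; exists (hits B w) => //; apply/cellP.
by move=> [J hJ] /cellP ->.
Qed.

Lemma mass_hits0 (B : set T') : measurable B ->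
  mass P [set w | hits B w == finset.set0] = (1 - mass mu B) ^+ n.
Proof.
move=> mB; rewrite (_ : [set w | _] = cell B finset.set0).
  rewrite mass_cell//; under eq_bigr do rewrite inE.
  by rewrite prodr_const card_ord.
by apply/seteqP; split => w /=; [move=> /eqP/cellP|move=> /cellP ->].
Qed.

(* A negative [lam] gives the lower tail. *)
Lemma mass_hits_chernoff (B : set T') (lam b : R) : measurable B ->
  mass P [set w | b <= lam * #|hits B w|%:R] <=
  expR (n%:R * mass mu B * (expR lam - 1) - b).
Proof.
move=> mB; set p := mass mu B.
pose phi := [pred J : {set 'I_n} | b <= lam * #|J|%:R].
apply: (@le_trans _ _ (\sum_(J | phi J) mass P (cell B J))).
  apply: mass_le_sum; first exact: (measurable_hits phi).
    by move=> J _; exact: measurable_cell.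
  by move=> w hw; exists (hits B w) => //; apply/cellP.
(* Exponential Markov inequality, cell by cell: the indicator of [b <= lam * #|J|] is at most
   [expR (lam * #|J| - b)]. *)
apply: (@le_trans _ _ (\sum_(J : {set 'I_n})
    expR (- b) * \prod_(i < n) (if i \in J then expR lam * p else 1 - p))).
  rewrite big_mkcond/=; apply: ler_sum => J _.
  have ge0 : 0 <= \prod_(i < n) (if i \in J then p else 1 - p).
    apply: prodr_ge0 => i _; case: ifP => _; first exact: mass_ge0.
    by rewrite subr_ge0 mass_le1.
  have -> : \prod_(i < n) (if i \in J then expR lam * p else 1 - p) =
     expR (lam * #|J|%:R) * \prod_(i < n) (if i \in J then p else 1 - p).
    rewrite expRM_natr -prodr_const [X in _ = X * _]big_mkcond -big_split/=.
    by apply: eq_bigr => i _; case: ifP => // _; rewrite mul1r.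
  rewrite mulrA -expRD; case: ifPn => hJ; last by rewrite mulr_ge0// expR_ge0.
  rewrite mass_cell// -[leLHS]mul1r ler_wpM2r//.
  by rewrite -[leLHS]expR0 ler_expR addrC subr_ge0.
rewrite -mulr_sumr.
(* Summed over all [J], the products expand a power of [expR lam * p + (1 - p)], the moment
   generating function of the count. It is then bounded by [1 + u <= expR u]. *)
have -> : \sum_(J : {set 'I_n})
      \prod_(i < n) (if i \in J then expR lam * p else 1 - p) =
    \prod_(i < n) (expR lam * p + (1 - p)).
  by rewrite bigA_distr.
rewrite prodr_const card_ord.
rewrite [in leRHS]addrC [in leRHS]expRD ler_wpM2l ?expR_ge0//.
rewrite -mulrA expRM_natl.
have p0 : 0 <= p by exact: mass_ge0.
have p1 : p <= 1 by exact: mass_le1.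
have := expR_ge0 lam => e0.
rewrite lerXn2r ?nnegrE ?expR_ge0//; first nra.
by apply: le_trans (expR_ge1Dx _); nra.
Qed.

End Hits.

(** * Uniform concentration of inversion counts *)

Lemma point_inversions_hits d (T : measurableType d) (R : realType)
    (P : probability T R) n (Z : 'I_n -> {RV P >-> (R * R)%type}) i w :
  point_inversions (fun j => Z j w) i = hits Z (inverted (Z i w)) w.
Proof.
apply/setP => j; rewrite !inE; apply/idP/idP => [/invertedP/mem_set//|].
by move=> /set_mem/invertedP.
Qed.

Lemma hits_sub d (T : measurableType d) d' (T' : measurableType d')
    (R : realType) (P : probability T R) n (Z : 'I_n -> {RV P >-> T'})
    (A B : set T') w : A `<=` B -> (#|hits Z A w| <= #|hits Z B w|)%N.
Proof.
move=> AB; apply: subset_leq_card; apply/fintype.subsetP => j.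
by rewrite !inE => /AB.
Qed.

Definition unit_square (R : realType) : set (R * R) :=
  [set z | 0 <= z.1 <= 1 /\ 0 <= z.2 <= 1].

(** There are [K.+1] cells instead of [K] because [x = 1] gets index [K]; the last cell sticks out
    of the unit interval. *)
Lemma grid_coordinate (R : realType) (K : nat) (x : R) : (0 < K)%N ->
  0 <= x <= 1 ->
  exists p : 'I_K.+1, p%:R / K%:R <= x <= p.+1%:R / K%:R.
Proof.
move=> K0 /andP[x0 x1].
have K0' : 0 < K%:R :> R by rewrite ltr0n.
have Kx0 : 0 <= x * K%:R by rewrite mulr_ge0.
have h : (Num.truncn (x * K%:R) < K.+1)%N.
  rewrite ltnS truncn_le_nat -natr1; apply: (@le_lt_trans _ _ K%:R); last lra.
  by rewrite ler_piMl.
exists (Ordinal h) => /=.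
rewrite ler_pdivrMr// ler_pdivlMr//.
by have /andP[-> /ltW ->] := truncn_itv Kx0.
Qed.

Section UniformTailBound.
Context d (T : measurableType d) (R : realType) (P : probability T R).
Context (mu : probability (R * R)%type R) (permu : is_permuton mu).
Context (n : nat) (Z : 'I_n -> {RV P >-> (R * R)%type}).
Hypothesis Z_iid : iid P Z mu.

(** A Chernoff bound for each selected set, followed by a union bound. The sign of [lam] is free, so
    both tails are covered; [r] bounds the exponent uniformly over the selected sets. *)
Lemma hits_union_bound (C : finType) (D : pred C) (B : C -> set (R * R))
    (lam b r : R) : (forall c, measurable (B c)) ->
  (forall c, D c -> mass mu (B c) * (expR lam - 1) <= r) ->
  exists E : set T, [/\ measurable E,
    mass P E <= #|C|%:R * expR (n%:R * r - b) &
    forall w, ~ E w -> forall c, D c -> lam * #|hits Z (B c) w|%:R < b].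
Proof.
move=> mB Dr.
pose F c := [set w | b <= lam * #|hits Z (B c) w|%:R].
have mF c : measurable (F c).
  exact: (measurable_hits Z [pred J : {set 'I_n} | b <= lam * #|J|%:R]).
have mE : measurable (\bigcup_(c in [set` D]) F c).
  exact: fin_bigcup_measurable.
exists (\bigcup_(c in [set` D]) F c); split => //.
- apply: le_trans (mass_le_sum P (D := D) (F := F) mE _ _) _ => //.
  apply: (@le_trans _ _ (\sum_(c : C) expR (n%:R * r - b))); last first.
    by rewrite sumr_const -[leLHS]mulr_natl.
  rewrite big_mkcond/=; apply: ler_sum => c _; case: ifPn => Dc.
    apply: le_trans (mass_hits_chernoff Z_iid _ _ (mB c)) _.
    by rewrite ler_expR lerB// -mulrA ler_wpM2l// Dr.
  exact: expR_ge0.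
- move=> w nE c Dc; rewrite ltNge; apply/negP => h; apply: nE.
  by exists c.
Qed.

Context (K : nat) (K_gt0 : (0 < K)%N).

(* All cells of the grid of mesh 1/K are treated at once: inside a cell the
   inversion set of a point is squeezed between two fixed sets whose masses
   differ by at most 2/K, because the marginals are uniform. *)
Let Cl := ('I_K.+1 * 'I_K.+1)%type.
Let inner (c : Cl) : set (R * R) :=
  antidiag (c.1%:R / K%:R) (c.1.+1%:R / K%:R)
           (c.2%:R / K%:R) (c.2.+1%:R / K%:R).
Let outer (c : Cl) : set (R * R) :=
  antidiag (c.1.+1%:R / K%:R) (c.1%:R / K%:R)
           (c.2.+1%:R / K%:R) (c.2%:R / K%:R).

Let grid_cell (z : R * R) : unit_square z ->
  exists c : Cl, [/\ inner c `<=` inverted z, inverted z `<=` outer c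
   & mass mu (outer c) <= mass mu (inner c) + 2 / K%:R].
Proof.
move=> [/(grid_coordinate K_gt0)[p hp] /(grid_coordinate K_gt0)[q hq]].
exists (p, q); split.
- exact: antidiag_inverted.
- exact: inverted_antidiag.
have K0 : 0 < K%:R :> R by rewrite ltr0n.
apply: le_trans (mass_antidiag_le permu _ _) _ => /=.
- by rewrite ler_pM2r ?invr_gt0// ler_nat.
- by rewrite ler_pM2r ?invr_gt0// ler_nat.
rewrite lerD2l -!natr1; lra.
Qed.

(** The union runs over the cells whose inner set has mass at least [q]. A point of inversion mass
    at least [q + 2 / K] lies in such a cell, and has at least as many inversions as its inner set
    has hits. *)
Lemma inversions_lower_tail (q a lam : R) : 0 < lam ->
  exists E : set T, [/\ measurable E,
    mass P E <= K.+1%:R ^+ 2 * expR (n%:R * (q * (expR (- lam) - 1)) + lam * a) &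
    forall w, ~ E w -> forall i, unit_square (Z i w) ->
      q + 2 / K%:R <= mass mu (inverted (Z i w)) ->
      a < #|point_inversions (fun j => Z j w) i|%:R].
Proof.
move=> lam0.
have el : expR (- lam) - 1 <= 0 by rewrite subr_le0 -[leRHS]expR0 ler_expR; lra.
have [|c Dc|E [mE PE hE]] := @hits_union_bound Cl
  [pred c | q <= mass mu (inner c)] inner (- lam) (- lam * a)
  (q * (expR (- lam) - 1)).
- by move=> c; exact: measurable_antidiag.
- exact: ler_wnM2r.
exists E; split => //.
  move: PE; rewrite card_prod card_ord natrM -expr2 => /le_trans; apply.
  by rewrite mulNr opprK.
move=> w /hE {}hE i /grid_cell[c [ci co cm]] hq.
have ic : q <= mass mu (inner c).
  have := le_mass mu (measurable_antidiag _ _ _ _) (measurable_antidiag _ _ _ _) co.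
  rewrite -/(inverted _); lra.
have := hE c ic; rewrite !mulNr ltrN2 ltr_pM2l// => /lt_le_trans; apply.
by rewrite ler_nat point_inversions_hits; exact: hits_sub.
Qed.

(** Mirror image of the lower tail: the union runs over the cells whose outer set has mass at most
    [q], and hits of the outer set bound the inversions from above. *)
Lemma inversions_upper_tail (q a lam : R) : 0 < lam ->
  exists E : set T, [/\ measurable E,
    mass P E <= K.+1%:R ^+ 2 * expR (n%:R * (q * (expR lam - 1)) - lam * a) &
    forall w, ~ E w -> forall i, unit_square (Z i w) ->
      mass mu (inverted (Z i w)) <= q - 2 / K%:R ->
      #|point_inversions (fun j => Z j w) i|%:R < a].
Proof.
move=> lam0.
have el : 0 <= expR lam - 1 by rewrite subr_ge0 -[leLHS]expR0 ler_expR; lra.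
have [|c Dc|E [mE PE hE]] := @hits_union_bound Cl
  [pred c | mass mu (outer c) <= q] outer lam (lam * a)
  (q * (expR lam - 1)).
- by move=> c; exact: measurable_antidiag.
- exact: ler_wpM2r.
exists E; split => //.
  by move: PE; rewrite card_prod card_ord natrM -expr2.
move=> w /hE {}hE i /grid_cell[c [ci co cm]] hq.
have ic : mass mu (outer c) <= q.
  have := le_mass mu (measurable_antidiag _ _ _ _) (measurable_antidiag _ _ _ _) ci.
  rewrite -/(inverted _); lra.
have := hE c ic; rewrite ltr_pM2l// => /(le_lt_trans _); apply.
by rewrite ler_nat point_inversions_hits; exact: hits_sub.
Qed.

End UniformTailBound.

(** The term of degree 6 of the exponential series suffices: [(c * sqrt n) ^ 6 = c ^ 6 * n ^ 3]
    beats [n ^ 2] by a factor [n]. *)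
Lemma sqr_expR_sqrt_le (R : realType) (c : R) (n : nat) : 0 < c -> (0 < n)%N ->
  n%:R ^+ 2 * expR (- (c * Num.sqrt n%:R)) <= 6`!%:R / c ^+ 6 / n%:R.
Proof.
move=> c0 n0; set r := Num.sqrt n%:R.
have n0' : 0 < n%:R :> R by rewrite ltr0n.
have r0 : 0 < r by rewrite sqrtr_gt0.
have r2 : r ^+ 2 = n%:R by rewrite sqr_sqrtr.
have cr0 : 0 < c * r by rewrite mulr_gt0.
have fac0 : 0 < 6`!%:R :> R by rewrite ltr0n fact_gt0.
have h : (c * r) ^+ 6 / 6`!%:R <= expR (c * r).
  by have := expR_ge1Dxn 5 (ltW cr0); lra.
rewrite expRN ler_pdivrMr ?expR_gt0//.
apply: le_trans (ler_wpM2l _ h); last by rewrite !divr_ge0 ?exprn_ge0// ltW.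
have r6 : r ^+ 6 = n%:R ^+ 3 by rewrite -r2 -exprM.
rewrite exprMn r6 le_eqVlt; apply/orP; left; apply/eqP.
by field; rewrite !gt_eqF.
Qed.

Lemma cvg_ge0_le_div (R : realType) (u : nat -> R) (C : R) :
  (forall n, 0 <= u n) -> (forall n, (0 < n)%N -> u n <= C / n%:R) ->
  u n @[n --> \oo] --> 0.
Proof.
move=> u0 uC; apply: (@squeeze_cvgr _ _ _ _ (fun=> 0) (fun n => C * n%:R^-1)).
- near=> n; rewrite u0/= uC//; near: n; exact: nbhs_infty_gt.
- exact: cvg_cst.
- rewrite -[X in _ --> X](mulr0 C); apply: cvgM; first exact: cvg_cst.
  apply/gtr0_cvgV0; last exact: cvgr_idn.
  by near=> n; rewrite ltr0n; near: n; exact: nbhs_infty_gt.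
Unshelve. all: by end_near. Qed.

(** * Uniform concentration at a scale [m], later taken to be [sqrt n] or [n] *)

Section Concentration.
Context (R : realType) (mu : probability (R * R)%type R).
Hypothesis permu : is_permuton mu.
Context (d : nat -> measure_display) (T : forall n, measurableType (d n))
  (P : forall n, probability (T n) R)
  (Z : forall n, 'I_n -> {RV P n >-> (R * R)%type}).
Arguments Z : clear implicits.
Hypothesis Z_iid : forall n, iid (P n) (Z n) mu.
Context (m : nat -> R)
  (m_bnd : forall n, Num.sqrt n%:R <= m n <= n%:R).

(** A grid of mesh [1 / (K0 * n)] has quadratically many cells, while the exponent is at least
    [c * sqrt n]; so the exceptional masses vanish. The events for the various [n] are picked by
    choice. *)
Let exceptional_sets (K0 : nat) (c : R) (good : forall n, T n -> Prop) :
  0 < c -> (0 < K0)%N ->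
  (forall n, (0 < n)%N -> exists E : set (T n), [/\ measurable E,
    mass (P n) E <= (K0 * n).+1%:R ^+ 2 * expR (- (c * m n)) &
    forall w, ~ E w -> good n w]) ->
  exists E : forall n, set (T n), [/\ forall n, measurable (E n),
    mass (P n) (E n) @[n --> \oo] --> 0 &
    forall n w, (0 < n)%N -> ~ E n w -> good n w].
Proof.
move=> c0 K00 H.
have {}H n : exists E : set (T n), measurable E /\ ((0 < n)%N ->
    mass (P n) E <= (K0 * n).+1%:R ^+ 2 * expR (- (c * m n)) /\
    forall w, ~ E w -> good n w).
  (* The hypothesis says nothing at [n = 0]; the empty set only makes the family total. *)
  case: (posnP n) => [->|n0]; first by exists set0.
  by have [E [? ? ?]] := H n n0; exists E.
pose E n := projT1 (cid (H n)).
have HE n : measurable (E n) /\ ((0 < n)%N ->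
    mass (P n) (E n) <= (K0 * n).+1%:R ^+ 2 * expR (- (c * m n)) /\
    forall w, ~ E n w -> good n w) by rewrite /E; case: cid.
exists E; split; first by move=> n; have [] := HE n.
- apply: (@cvg_ge0_le_div _ _ ((2 * K0%:R) ^+ 2 * (6`!%:R / c ^+ 6))) => n.
    exact: mass_ge0.
  move=> n0; have [_ /(_ n0)[+ _]] := HE n; move=> /le_trans; apply.
  rewrite -[leRHS]mulrA.
  have A0 : 0 <= (2 * K0%:R) ^+ 2 :> R by rewrite exprn_ge0// mulr_ge0.
  apply: le_trans _ (ler_wpM2l A0 (sqr_expR_sqrt_le c0 n0)).
  rewrite mulrA -exprMn; apply: ler_pM; rewrite ?exprn_ge0 ?expR_ge0//.
    rewrite lerXn2r ?nnegrE ?mulr_ge0// -natrM -natrM ler_nat.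
    by rewrite -mulnA mul2n -addnn -addn1 leq_add2l muln_gt0 K00.
  rewrite ler_expR lerN2 ler_pM2l//.
  by have /andP[] := m_bnd n.
- by move=> n w n0; have [_ /(_ n0)[_]] := HE n; exact.
Qed.

(** Multiplied by [n], the grid error is the constant [2 / K0]. It is absorbed by [eps / 2 * m n]
    once [K0 > 4 / eps], because [m n >= 1]. *)
Let mesh (eps : R) : 0 < eps -> exists K0 : nat, (0 < K0)%N /\
  forall n, (0 < n)%N ->
    0 < m n /\ n%:R * (2 / (K0 * n)%:R) <= eps / 2 * m n.
Proof.
move=> e0; exists (Num.truncn (4 / eps)).+1; split => [//|n n0].
have n0' : 0 < n%:R :> R by rewrite ltr0n.
have n1' : 1 <= n%:R :> R by rewrite ler1n.
have m1 : 1 <= m n.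
  have /andP[+ _] := m_bnd n; apply: le_trans.
  by rewrite -[leLHS]sqrtr1 ler_wsqrtr.
split; first by lra.
have := truncnS_gt (4 / eps); move: (Num.truncn _).+1 => K h.
have K0p : 0 < K%:R :> R by rewrite (lt_trans _ h)// divr_gt0.
have -> : n%:R * (2 / (K * n)%:R) = 2 / K%:R :> R.
  by rewrite natrM; field; rewrite !gt_eqF.
apply: (@le_trans _ _ (eps / 2)); last by rewrite ler_peMr// divr_ge0// ltW.
by move: h; rewrite ltr_pdivrMr// ler_pdivrMr//; lra.
Qed.

Lemma inversions_gt_whp (s eps : R) : 0 <= s -> 0 < eps ->
  exists E : forall n, set (T n), [/\ forall n, measurable (E n),
    mass (P n) (E n) @[n --> \oo] --> 0 &
    forall n w, (0 < n)%N -> ~ E n w ->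
      forall i, unit_square (Z n i w) ->
      (s + eps) * m n <= n%:R * mass mu (inverted (Z n i w)) ->
      s * m n < #|point_inversions (fun j => Z n j w) i|%:R].
Proof.
move=> s0 e0; have [K0 [K00 hK]] := mesh e0.
(* Chosen so that [lam * s < eps / 2]. This makes the exponent [c] positive, as
   [1 - expR (- lam) >= lam / (1 + lam)]. The summand [2 * eps] keeps the denominator positive at
   [s = 0]. *)
pose lam : R := eps / (4 * s + 2 * eps).
have lam0 : 0 < lam by rewrite divr_gt0//; lra.
have lamE : lam * (4 * s + 2 * eps) = eps.
  by rewrite /lam mulfVK// gt_eqF//; lra.
have lams : lam * s < eps / 2 by nra.
pose c := (s + eps / 2) * (1 - expR (- lam)) - lam * s.
have c0 : 0 < c.
  have h1 : expR lam >= 1 + lam by exact: expR_ge1Dx.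
  have h2 : expR (- lam) * expR lam = 1 by rewrite -expRD addNr expR0.
  have h3 : expR (- lam) <= (1 + lam)^-1.
    rewrite -[leRHS]mul1r ler_pdivlMr; last lra.
    by rewrite -[leRHS]h2 ler_wpM2l// expR_ge0.
  have h4 : 1 - (1 + lam)^-1 = lam * (1 + lam)^-1 by field; rewrite gt_eqF//; lra.
  have h5 : 0 < (1 + lam)^-1 by rewrite invr_gt0; lra.
  have h6 : (1 + lam) * (1 + lam)^-1 = 1 by rewrite mulfV// gt_eqF//; lra.
  apply: (@lt_le_trans _ _ ((s + eps / 2) * (lam * (1 + lam)^-1) - lam * s)).
    have -> : (s + eps / 2) * (lam * (1 + lam)^-1) - lam * s =
        lam * (1 + lam)^-1 * (eps / 2 - lam * s).
      by field; rewrite gt_eqF//; lra.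
    apply: mulr_gt0; first exact: mulr_gt0.
    by rewrite subr_gt0.
  rewrite lerD2r ler_wpM2l//; lra.
apply: (exceptional_sets c0 K00) => n n0.
have [mn0 hKn] := hK n n0.
have n0' : 0 < n%:R :> R by rewrite ltr0n.
have Kn0 : (0 < K0 * n)%N by rewrite muln_gt0 K00.
(* Half of the margin [eps] goes to the Chernoff exponent, the other half to the grid error. *)
have [E [mE PE hE]] := inversions_lower_tail permu (@Z_iid n) Kn0
  ((s + eps / 2) * m n / n%:R) (s * m n) lam0.
exists E; split => //.
  apply: le_trans PE _; rewrite ler_wpM2l ?exprn_ge0// ler_expR.
  rewrite le_eqVlt; apply/orP; left; apply/eqP; rewrite /c.
  by field; rewrite gt_eqF.
move=> w /hE {}hE i /hE {}hE hq; apply: hE.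
have -> : (s + eps / 2) * m n / n%:R + 2 / (K0 * n)%:R =
   ((s + eps / 2) * m n + n%:R * (2 / (K0 * n)%:R)) / n%:R.
  by field; rewrite !gt_eqF// ltr0n.
rewrite ler_pdivrMr// mulrC; lra.
Qed.

Lemma inversions_lt_whp (s eps : R) : 0 < eps -> eps < s ->
  exists E : forall n, set (T n), [/\ forall n, measurable (E n),
    mass (P n) (E n) @[n --> \oo] --> 0 &
    forall n w, (0 < n)%N -> ~ E n w ->
      forall i, unit_square (Z n i w) ->
      n%:R * mass mu (inverted (Z n i w)) <= (s - eps) * m n ->
      #|point_inversions (fun j => Z n j w) i|%:R < s * m n].
Proof.
move=> e0 es; have [K0 [K00 hK]] := mesh e0.
(* Again [lam * s < eps / 2], now combined with [expR lam <= 1 / (1 - lam)], which needs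
   [lam < 1]. *)
pose lam : R := eps / (4 * s).
have lam0 : 0 < lam by rewrite divr_gt0//; lra.
have lamE : lam * (4 * s) = eps.
  by rewrite /lam mulfVK// gt_eqF//; lra.
have lams : lam * s < eps / 2 by nra.
have lam1 : lam < 1 by nra.
pose c := lam * s - (s - eps / 2) * (expR lam - 1).
have c0 : 0 < c.
  have h1 : expR (- lam) >= 1 - lam by exact: expR_ge1Dx.
  have h2 : expR (- lam) * expR lam = 1 by rewrite -expRD addNr expR0.
  have h3 : expR lam <= (1 - lam)^-1.
    rewrite -[leRHS]mul1r ler_pdivlMr; last lra.
    by rewrite -[leRHS]h2 mulrC ler_wpM2r// expR_ge0.
  have h4 : (1 - lam)^-1 - 1 = lam * (1 - lam)^-1 by field; rewrite gt_eqF//; lra.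
  have h5 : 0 < (1 - lam)^-1 by rewrite invr_gt0; lra.
  apply: (@lt_le_trans _ _ (lam * s - (s - eps / 2) * (lam * (1 - lam)^-1))).
    have -> : lam * s - (s - eps / 2) * (lam * (1 - lam)^-1) =
        lam * (1 - lam)^-1 * (eps / 2 - lam * s).
      by field; rewrite gt_eqF//; lra.
    apply: mulr_gt0; first exact: mulr_gt0.
    by rewrite subr_gt0.
  rewrite lerD2l lerN2 ler_wpM2l//; lra.
apply: (exceptional_sets c0 K00) => n n0.
have [mn0 hKn] := hK n n0.
have n0' : 0 < n%:R :> R by rewrite ltr0n.
have Kn0 : (0 < K0 * n)%N by rewrite muln_gt0 K00.
have [E [mE PE hE]] := inversions_upper_tail permu (@Z_iid n) Kn0
  ((s - eps / 2) * m n / n%:R) (s * m n) lam0.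
exists E; split => //.
  apply: le_trans PE _; rewrite ler_wpM2l ?exprn_ge0// ler_expR.
  rewrite le_eqVlt; apply/orP; left; apply/eqP; rewrite /c.
  by field; rewrite gt_eqF.
move=> w /hE {}hE i /hE {}hE hq; apply: hE.
have -> : (s - eps / 2) * m n / n%:R - 2 / (K0 * n)%:R =
   ((s - eps / 2) * m n - n%:R * (2 / (K0 * n)%:R)) / n%:R.
  by field; rewrite !gt_eqF// ltr0n.
rewrite ler_pdivlMr// mulrC; lra.
Qed.

End Concentration.

(** * Geometry of a tiling *)

Section TilingGeometry.
Context (R : realType) (k : nat) (t : tiling R k).
Local Notation x := (tile_x t).
Local Notation y := (tile_y t).
Local Notation side := (tile_side t).

Lemma tile_bounds l :
  [/\ 0 <= x l, x l + side l <= 1, 0 <= y l & y l + side l <= 1].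
Proof.
have s0 := tile_side_gt0 t l.
have [] : (`[0, 1] `*` `[0, 1] : set (R * R)) (x l, y l).
  apply: (@tile_sub01 _ _ t l).
  by split => /=; rewrite in_itv/= lexx lerDl ltW.
have [] : (`[0, 1] `*` `[0, 1] : set (R * R)) (x l + side l, y l + side l).
  apply: (@tile_sub01 _ _ t l).
  by split => /=; rewrite in_itv/= lexx lerDl ltW.
by rewrite /= !in_itv/= => /andP[_ ?] /andP[_ ?] /andP[? _] /andP[? _]; split.
Qed.

(** If the intervals overlapped, the midpoint between the later left end and the smaller right end
    would lie in both interiors. *)
Let disjoint_le (c : 'I_k -> R) l m :
  trivIset [set: 'I_k] (fun l => `[c l, c l + side l]%classic°) ->
  c l < c m -> c l + side l <= c m.
Proof.
move=> tI clm; rewrite leNgt; apply/negP => h.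
have sl := tile_side_gt0 t l; have sm := tile_side_gt0 t m.
pose e := Num.min (c l + side l) (c m + side m).
have e1 : c m < e by rewrite /e lt_min h ltrDl.
have e2 : e <= c l + side l by rewrite /e ge_min lexx.
have e3 : e <= c m + side m by rewrite /e ge_min lexx orbT.
have lm : l = m; last by move: clm; rewrite lm ltxx.
apply: tI => //; exists ((c m + e) / 2).
by split; rewrite interior_itv /= in_itv/=; lra.
Qed.

Lemma tile_x_le l m : x l < x m -> x l + side l <= x m.
Proof. exact/disjoint_le/tile_x_disj. Qed.

Lemma tile_y_le l m : y l < y m -> y l + side l <= y m.
Proof. exact/disjoint_le/tile_y_disj. Qed.

Lemma tile_x_mono l m : (x l < x m) = (l < m)%N.
Proof.
apply/idP/idP => [h|/tile_x_lt//]; rewrite ltnNge; apply/negP.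
rewrite leq_eqVlt => /orP[/eqP/val_inj ml|/(@tile_x_lt _ _ t)].
  by move: h; rewrite ml ltxx.
by move=> /(lt_trans h); rewrite ltxx.
Qed.

Lemma tile_x_inj l m : x l = x m -> l = m.
Proof.
move=> h; case: (ltngtP l m) => [/(@tile_x_lt _ _ t)|/(@tile_x_lt _ _ t)|/val_inj//];
  by rewrite h ltxx.
Qed.

Lemma tiling_inversionsP l m :
  (m \in perm_inversions (tiling_perm t) l) = ((x l - x m) * (y l - y m) < 0).
Proof.
by rewrite inE !mulBB_lt0 !ltz_nat !tiling_permP !tile_x_mono.
Qed.

(** Open tiles are pairwise disjoint, and passing to them costs no mass since lines are null. *)
Definition tile_int (l : 'I_k) : set (R * R) :=
  [set w | x l < w.1 < x l + side l /\ y l < w.2 < y l + side l].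

Lemma tile_int_tile l w : tile_int l w -> tile t l w.
Proof. by move=> [? ?]; split => /=; rewrite in_itv/=; lra. Qed.

Lemma measurable_tile l : measurable (tile t l).
Proof. by apply: measurableX. Qed.

Lemma measurable_tile_int l : measurable (tile_int l).
Proof.
rewrite (_ : tile_int l = `]x l, x l + side l[ `*` `]y l, y l + side l[).
  exact: measurableX.
by apply/seteqP; split => w [] /=; rewrite !in_itv.
Qed.

Lemma tile_int_col l m w : x l < w.1 < x l + side l -> tile t m w -> l = m.
Proof.
move=> h [/= + _]; rewrite in_itv/= => h'.
by case: (ltgtP (x l) (x m)) => [/tile_x_le ?|/tile_x_le ?|/tile_x_inj//]; exfalso; lra.
Qed.

Lemma tile_int_row l m w : y l < w.2 < y l + side l -> tile t m w -> l = m.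
Proof.
move=> h [/= _]; rewrite in_itv/= => h'.
by case: (ltgtP (y l) (y m)) => [/tile_y_le ?|/tile_y_le ?|/tile_y_inj//]; exfalso; lra.
Qed.

End TilingGeometry.

(** * Masses forced by the uniform marginals when the support lies in the tiles *)

Section TilingMass.
Context (R : realType) (k : nat) (t : tiling R k).
Context (mu : probability (R * R)%type R) (permu : is_permuton mu).
Hypothesis mu_supp : mu (\bigcup_l tile t l) = 1%E.
Local Notation x := (tile_x t).
Local Notation y := (tile_y t).
Local Notation side := (tile_side t).

Let msupp : measurable (\bigcup_l tile_int t l).
Proof. by apply: fin_bigcup_measurable => // l _; exact: measurable_tile_int. Qed.

Lemma measurable_between_fst (a b : R) :
  measurable [set w : R * R | a < w.1 < b].
Proof. exact: (measurable_strip measurable_fst (A := `]a, b[)). Qed.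

Lemma measurable_between_snd (a b : R) :
  measurable [set w : R * R | a < w.2 < b].
Proof. exact: (measurable_strip measurable_snd (A := `]a, b[)). Qed.

Lemma measurable_eq_fst (a : R) : measurable [set w : R * R | w.1 = a].
Proof. exact: (measurable_strip measurable_fst (A := [set a])). Qed.

Lemma measurable_eq_snd (a : R) : measurable [set w : R * R | w.2 = a].
Proof. exact: (measurable_strip measurable_snd (A := [set a])). Qed.

Let mass_line1 (a : R) : mass mu [set w | w.1 = a] = 0.
Proof. exact: (mass_line measurable_fst (permuton_fst permu)). Qed.

Let mass_line2 (a : R) : mass mu [set w | w.2 = a] = 0.
Proof. exact: (mass_line measurable_snd (permuton_snd permu)). Qed.

(** The boundary lies on four lines, each null by the uniform marginals. *)
Lemma mass_tile_boundary l : mass mu (tile t l `\` tile_int t l) = 0.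
Proof.
have m1 := measurable_eq_fst (x l).
have m2 := measurable_eq_fst (x l + side l).
have m3 := measurable_eq_snd (y l).
have m4 := measurable_eq_snd (y l + side l).
have mE : measurable (tile t l `\` tile_int t l).
  by apply: measurableD; [exact: measurable_tile|exact: measurable_tile_int].
have m12 := measurableU _ _ m1 m2; have m34 := measurableU _ _ m3 m4.
have h12 := le_massU mu m12 m1 m2 (@subset_refl _ _).
have h34 := le_massU mu m34 m3 m4 (@subset_refl _ _).
have h : mass mu (tile t l `\` tile_int t l) <= _ := le_massU mu mE m12 m34 _.
apply/eqP; rewrite eq_le mass_ge0 andbT; apply: le_trans (h _) _; last first.
  by move: h12 h34; rewrite !mass_line1 !mass_line2; lra.
move=> w [[/= + +] nw]; rewrite !in_itv/= => h1 h2.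
apply: contrapT => nl; apply: nw; split.
  rewrite !lt_neqAle; case/andP: h1 => -> ->; rewrite !andbT.
  by apply/andP; split; apply/eqP => e; apply: nl; left; [left|right].
rewrite !lt_neqAle; case/andP: h2 => -> ->; rewrite !andbT.
by apply/andP; split; apply/eqP => e; apply: nl; right; [left|right].
Qed.

Lemma mass_tiles_int : mass mu (\bigcup_l tile_int t l) = 1.
Proof.
have mt : measurable (\bigcup_l tile t l).
  by apply: fin_bigcup_measurable => // l _; exact: measurable_tile.
have t1 : mass mu (\bigcup_l tile t l) = 1 by rewrite /mass mu_supp.
have mD l : measurable (tile t l `\` tile_int t l).
  by apply: measurableD; [exact: measurable_tile|exact: measurable_tile_int].
have mDU : measurable (\bigcup_l (tile t l `\` tile_int t l)).
  exact: fin_bigcup_measurable.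
have h : mass mu (\bigcup_l (tile t l `\` tile_int t l)) <=
    \sum_(l < k) mass mu (tile t l `\` tile_int t l).
  by apply: mass_le_sum => // w [l _ h]; exists l.
rewrite big1 in h; last by move=> l _; exact: mass_tile_boundary.
apply/eqP; rewrite eq_le mass_le1//= -t1.
apply: le_trans (le_massU mu mt msupp mDU _) _; last lra.
move=> w [l _ wl]; case: (pselect (tile_int t l w)) => h'; first by left; exists l.
by right; exists l.
Qed.

Lemma le_mass_tiles (A B : set (R * R)) : measurable A -> measurable B ->
  (forall l w, tile_int t l w -> A w -> B w) -> mass mu A <= mass mu B.
Proof.
move=> mA mB AB.
have mC := measurableC msupp.
have h := le_massU mu mA mB mC _.
have h0 : mass mu (~` \bigcup_l tile_int t l) = 0.
  by rewrite mass_setC// mass_tiles_int subrr.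
rewrite h0 addr0 in h; apply: h => w Aw.
case: (pselect ((\bigcup_l tile_int t l) w)) => [[l _ wl]|]; last by right.
by left; exact: AB wl Aw.
Qed.

(** No other tile meets this column, so the whole mass of the column, known from the marginal, sits
    in the tile. *)
Lemma mass_tile_col l (a b : R) : x l <= a -> a <= b -> b <= x l + side l ->
  mass mu (tile_int t l `&` [set w | a < w.1 < b]) = b - a.
Proof.
move=> xa ab bx; have [x0 x1 _ _] := tile_bounds t l.
rewrite -(mass_open_strip measurable_fst (permuton_fst permu) _ ab _); [|lra|lra].
have m1 := measurable_between_fst a b.
have m2 := measurableI _ _ (measurable_tile_int t l) m1.
apply/eqP; rewrite eq_le; apply/andP; split; first by apply: le_mass => // w [].
apply: le_mass_tiles => // m w wm wab; split => //.
rewrite (@tile_int_col _ _ t l m w) //; last exact: tile_int_tile.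
by move: wab => /=; lra.
Qed.

Lemma mass_tile_row l (a b : R) : y l <= a -> a <= b -> b <= y l + side l ->
  mass mu (tile_int t l `&` [set w | a < w.2 < b]) = b - a.
Proof.
move=> xa ab bx; have [_ _ y0 y1] := tile_bounds t l.
rewrite -(mass_open_strip measurable_snd (permuton_snd permu) _ ab _); [|lra|lra].
have m1 := measurable_between_snd a b.
have m2 := measurableI _ _ (measurable_tile_int t l) m1.
apply/eqP; rewrite eq_le; apply/andP; split; first by apply: le_mass => // w [].
apply: le_mass_tiles => // m w wm wab; split => //.
rewrite (@tile_int_row _ _ t l m w) //; last exact: tile_int_tile.
by move: wab => /=; lra.
Qed.

Lemma mass_tile_int l : mass mu (tile_int t l) = side l.
Proof.
have s0 := tile_side_gt0 t l.
have := @mass_tile_col l (x l) (x l + side l).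
rewrite setIidl; last by move=> w [].
by move=> ->; lra.
Qed.

Lemma tile_int_inj l m w : tile_int t l w -> tile_int t m w -> l = m.
Proof. by move=> [h _] /tile_int_tile; exact: tile_int_col. Qed.

(** The total mass of the tiles inverted with tile [l], since a tile has mass equal to its side. *)
Definition inversion_mass l : R :=
  \sum_(m in perm_inversions (tiling_perm t) l) side m.

(** The tiles are disjoint, so their masses add up to at most 1. This makes the default value 1
    harmless when [min_tiling_inversion] is identified with an attained minimum. *)
Lemma inversion_mass_le1 l : inversion_mass l <= 1.
Proof.
rewrite /inversion_mass; under eq_bigr do rewrite -mass_tile_int.
apply: le_trans (mass_sum_le (A := setT) mu _ _ _ _) (mass_le1 _ _) => //.
- by move=> *; exact: measurable_tile_int.
- by move=> i j w _ _; exact: tile_int_inj.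
Qed.

Lemma min_tiling_inversion_le l : min_tiling_inversion t <= inversion_mass l.
Proof. exact: bigmin_le_cond. Qed.

Lemma min_tiling_inversion_ge (l0 : 'I_k) :
  exists l, inversion_mass l <= min_tiling_inversion t.
Proof.
exists [arg min_(l < l0) inversion_mass l]%O.
by rewrite /min_tiling_inversion (@bigmin_eq_arg _ _ _ _ l0)// => l _;
  exact: inversion_mass_le1.
Qed.

Let tile_inverted l m w z : m \in perm_inversions (tiling_perm t) l ->
  tile t l z -> tile_int t m w -> inverted z w.
Proof.
rewrite tiling_inversionsP mulBB_lt0 => lm [/= + +] [w1 w2].
rewrite !in_itv/= => z1 z2.
case/orP: lm => /andP[/tile_x_le ? /tile_y_le ?]; [right|left]; split => /=; lra.
Qed.

(** Every point of tile [l] is inverted with all points of each open tile in inverted position, and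
    these tiles are disjoint. *)
Lemma inversion_mass_le l z : tile t l z ->
  inversion_mass l <= mass mu (inverted z).
Proof.
move=> zl; rewrite /inversion_mass; under eq_bigr do rewrite -mass_tile_int.
apply: mass_sum_le => //.
- exact: measurable_antidiag.
- by move=> *; exact: measurable_tile_int.
- by move=> i j w _ _; exact: tile_int_inj.
- by move=> m lm w; exact: tile_inverted lm zl.
Qed.

Lemma inversion_mass_ge_side l : perm_inversions (tiling_perm t) l != finset.set0 ->
  exists m, side m <= inversion_mass l.
Proof.
case/set0Pn => m lm; exists m; rewrite /inversion_mass (bigD1 m)//= lerDl.
by apply: sumr_ge0 => i _; exact/ltW/tile_side_gt0.
Qed.

(* Coordinates measured from the bottom-left ([b = false]) or top-right
   ([b = true]) corner of a tile, both pointing inwards. *)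
Definition corner_x l (b : bool) (z : R * R) : R :=
  if b then x l + side l - z.1 else z.1 - x l.

Definition corner_y l (b : bool) (z : R * R) : R :=
  if b then y l + side l - z.2 else z.2 - y l.

(** Up to a null set, a point inverted with [z] lies in a tile inverted with tile [l], or in tile
    [l] itself. In the latter case it lies in the vertical or horizontal strip between [z] and the
    chosen corner. *)
Lemma inverted_mass_le l b z : tile t l z ->
  mass mu (inverted z) <= inversion_mass l + (corner_x l b z + corner_y l b z).
Proof.
move=> zl.
pose V := \bigcup_(m in [set` perm_inversions (tiling_perm t) l]) tile_int t m.
have mV : measurable V.
  by apply: fin_bigcup_measurable => // m _; exact: measurable_tile_int.
have hV : mass mu V <= inversion_mass l.
  rewrite /inversion_mass; under eq_bigr do rewrite -mass_tile_int.
  apply: mass_le_sum => //; first by move=> *; exact: measurable_tile_int.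
have [/=] := zl; rewrite !in_itv/= => z1 z2.
pose x1 := if b then z.1 else x l; pose x2 := if b then x l + side l else z.1.
pose y1 := if b then z.2 else y l; pose y2 := if b then y l + side l else z.2.
have x12 : x1 <= x2 by rewrite /x1 /x2; case: ifP => _; lra.
have y12 : y1 <= y2 by rewrite /y1 /y2; case: ifP => _; lra.
pose S1 := [set w : R * R | x1 <= w.1 <= x2].
pose S2 := [set w : R * R | y1 <= w.2 <= y2].
have m1 : measurable S1.
  exact: (measurable_strip measurable_fst (A := `[x1, x2])).
have m2 : measurable S2.
  exact: (measurable_strip measurable_snd (A := `[y1, y2])).
have h1 : mass mu S1 <= x2 - x1 by apply: mass_strip_le => //; exact: permuton_fst.
have h2 : mass mu S2 <= y2 - y1 by apply: mass_strip_le => //; exact: permuton_snd.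
have m12 := measurableU _ _ m1 m2.
have h12 := le_massU mu m12 m1 m2 (@subset_refl _ _).
have mVS := measurableU _ _ mV m12.
have hVS := le_massU mu mVS mV m12 (@subset_refl _ _).
have : corner_x l b z + corner_y l b z = (x2 - x1) + (y2 - y1).
  by rewrite /corner_x /corner_y /x1 /x2 /y1 /y2; case: (b).
move=> ->; apply: (@le_trans _ _ (mass mu (V `|` (S1 `|` S2)))); last lra.
apply: le_mass_tiles => //; first exact: measurable_antidiag.
move=> m w wm /invertedP zw.
have [wm1 wm2] := wm.
case: (boolP (m \in perm_inversions (tiling_perm t) l)) => lm; first by left; exists m.
right; case: (eqVneq l m) => [elm|nlm].
  move: zw; rewrite mulBB_lt0 => zw; subst m.
  have [c1|c1] := pselect (S1 w); [by left|right].
  move: c1 zw; rewrite /S1 /S2 /x1 /x2 /y1 /y2 /=.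
  by case: b {x1 x2 y1 y2 x12 y12 S1 S2 m1 m2 h1 h2 m12 h12 mVS hVS} => /= c1 zw; lra.
exfalso; move: lm; rewrite tiling_inversionsP mulBB_lt0.
move: zw; rewrite mulBB_lt0.
have nx : x l != x m by apply: contraNneq nlm => /tile_x_inj ->.
have ny : y l != y m by apply: contraNneq nlm => /tile_y_inj ->.
move: nx ny; rewrite !neq_lt => /orP[] ltx /orP[] lty; rewrite ltx lty ?orbT//=;
  move: (tile_x_le ltx) (tile_y_le lty) => ? ?; lra.
Qed.

Definition corner_box l b (z : R * R) : set (R * R) :=
  tile_int t l `&`
  [set w | corner_x l b w <= corner_x l b z /\ corner_y l b w <= corner_y l b z].

Lemma corner_boxE l b z : corner_box l b z =
  tile_int t l `&` (if b then [set w | z.1 <= w.1] `&` [set w | z.2 <= w.2]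
                    else [set w | w.1 <= z.1] `&` [set w | w.2 <= z.2]).
Proof.
rewrite /corner_box /corner_x /corner_y; congr (_ `&` _).
by case: b; apply/seteqP; split => w [/= ? ?]; split => /=; lra.
Qed.

Lemma measurable_corner_box l b z : measurable (corner_box l b z).
Proof.
rewrite corner_boxE; apply: measurableI; first exact: measurable_tile_int.
case: b; apply: measurableI.
- rewrite (_ : [set w | _] = ~` [set w : R * R | w.1 < z.1]).
    exact: measurableC (measurable_lt_fst _).
  by apply/seteqP; split => w /=; rewrite leNgt => /negP.
- rewrite (_ : [set w | _] = ~` [set w : R * R | w.2 < z.2]).
    exact: measurableC (measurable_lt_snd _).
  by apply/seteqP; split => w /=; rewrite leNgt => /negP.
- rewrite (_ : [set w | _] = ~` [set w : R * R | z.1 < w.1]).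
    exact: measurableC (measurable_gt_fst _).
  by apply/seteqP; split => w /=; rewrite leNgt => /negP.
- rewrite (_ : [set w | _] = ~` [set w : R * R | z.2 < w.2]).
    exact: measurableC (measurable_gt_snd _).
  by apply/seteqP; split => w /=; rewrite leNgt => /negP.
Qed.

(* The points of the tile between the corner and z horizontally (resp.
   vertically) have mass equal to the distance, and those outside the corner
   box are inverted with z. *)
Lemma inverted_mass_ge l b z : tile t l z ->
  corner_x l b z + corner_y l b z - 2 * mass mu (corner_box l b z) <=
  mass mu (inverted z).
Proof.
move=> [/=]; rewrite !in_itv/= => z1 z2.
pose C := if b then tile_int t l `&` [set w | z.1 < w.1 < x l + side l]
          else tile_int t l `&` [set w | x l < w.1 < z.1].
pose D := if b then tile_int t l `&` [set w | z.2 < w.2 < y l + side l]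
          else tile_int t l `&` [set w | y l < w.2 < z.2].
have mC : measurable C.
  by rewrite /C; case: (b); apply: measurableI;
    (exact: measurable_tile_int || exact: measurable_between_fst).
have mD : measurable D.
  by rewrite /D; case: (b); apply: measurableI;
    (exact: measurable_tile_int || exact: measurable_between_snd).
have hC : mass mu C = corner_x l b z.
  by rewrite /C /corner_x; case: (b); rewrite mass_tile_col//; lra.
have hD : mass mu D = corner_y l b z.
  by rewrite /D /corner_y; case: (b); rewrite mass_tile_row//; lra.
have mB := measurable_corner_box l b z.
have mCB := measurableD mC mB; have mDB := measurableD mD mB.
have h1 := le_massU mu mC mCB mB _.
have h2 := le_massU mu mD mDB mB _.
have sub A : A `<=` (A `\` corner_box l b z) `|` corner_box l b z.
  by move=> w Aw; case: (pselect (corner_box l b z w)); [right|left].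
have {}h1 := h1 (sub _); have {}h2 := h2 (sub _).
(* The corner box is removed once from the column and once from the row, whence the factor 2. *)
have : mass mu (C `\` corner_box l b z) + mass mu (D `\` corner_box l b z) <=
    mass mu (inverted z); last by lra.
apply: massU_le => //; first exact: measurable_antidiag.
- move=> w []; rewrite /C corner_boxE; case: (b) => -[wl /= w1] nw.
    right; split => /=; first lra.
    by rewrite ltNge; apply/negP => h; apply: nw; split => //; split => //=; lra.
  left; split => /=; first lra.
  by rewrite ltNge; apply/negP => h; apply: nw; split => //; split => //=; lra.
- move=> w []; rewrite /D corner_boxE; case: (b) => -[wl /= w1] nw.
    left; split => /=; last lra.
    by rewrite ltNge; apply/negP => h; apply: nw; split => //; split => //=; lra.
  right; split => /=; last lra.
  by rewrite ltNge; apply/negP => h; apply: nw; split => //; split => //=; lra.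
- move=> w []; rewrite /C /D corner_boxE; case: (b) => -[wl /= w1] nw [[_ /= w2] _];
  by apply: nw; split => //; split => //=; lra.
Qed.

Definition NW_box l (e : R) : set (R * R) :=
  [set w | x l < w.1 < x l + e /\ y l + side l - e < w.2 < y l + side l].
Definition SE_box l (e : R) : set (R * R) :=
  [set w | x l + side l - e < w.1 < x l + side l /\ y l < w.2 < y l + e].

(** A point away from the bottom-left and top-right corners has the whole top-left box in its upper
    left quadrant, or the whole bottom-right box in its lower right quadrant. *)
Lemma inverted_mass_ge_boxes l (e c : R) z : tile t l z -> 2 * e < side l ->
  c <= mass mu (NW_box l e) -> c <= mass mu (SE_box l e) ->
  (forall b, e < corner_x l b z \/ e < corner_y l b z) ->
  c <= mass mu (inverted z).
Proof.
move=> [/=]; rewrite !in_itv/= => z1 z2 e2 cNW cSE far.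
have mNW : measurable (NW_box l e).
  by apply: measurableI; [exact: measurable_between_fst|exact: measurable_between_snd].
have mSE : measurable (SE_box l e).
  by apply: measurableI; [exact: measurable_between_fst|exact: measurable_between_snd].
have mI : measurable (inverted z) by exact: measurable_antidiag.
(* When both distance conditions concern the same coordinate, [2 * e < side l] makes the other
   coordinate far from at least one end of its side. *)
have [h|h] : (e < z.1 - x l /\ e < y l + side l - z.2) \/
    (e < z.2 - y l /\ e < x l + side l - z.1).
  have := far true; have := far false; rewrite /corner_x /corner_y.
  by move=> [?|?] [?|?]; case: (ltP e (z.2 - y l)) => ?; case: (ltP e (z.1 - x l)) => ?;
   ((left; lra) || (right; lra)).
- apply: le_trans cNW _; apply: le_mass => // w [/= w1 w2].
  by left; split => /=; lra.
- apply: le_trans cSE _; apply: le_mass => // w [/= w1 w2].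
  by right; split => /=; lra.
Qed.

End TilingMass.

(** * Densities near the corners *)

Section TriangleArea.
Context (R : realType).
Local Notation lambda := (@lebesgue_measure R).

Lemma integral_affine (a b p q : R) : a < b ->
  (\int[lambda]_(x in `]a, b[) (p + q * x)%:E =
   (p * (b - a) + q * (b ^+ 2 - a ^+ 2) / 2)%:E)%E.
Proof.
move=> ab.
have cf : continuous (fun x : R => p + q * x).
  move=> x; apply: cvgD; first exact: cvg_cst.
  by apply: cvgM; [exact: cvg_cst|exact: cvg_id].
have mf : measurable_fun `[a, b] (fun x : R => (p + q * x)%:E).
  apply/measurable_EFinP; apply: measurable_funTS.
  exact: continuous_measurable_fun.
rewrite integral_itv_bndo_bndc; last first.
  by apply: measurable_funS mf => // x /=; rewrite !in_itv/=; lra.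
rewrite integral_itv_obnd_cbnd; last first.
  by apply: measurable_funS mf => // x /=; rewrite !in_itv/=; lra.
pose F : R -> R := fun x => p * x + q / 2 * x ^+ 2.
have dF (x : R) : is_derive x 1 F (p + q * x).
  have h1 : is_derive x 1 (fun x : R => p * x) (p * 1).
    by apply: is_deriveZ.
  have h2 : is_derive x 1 (fun x : R => q / 2 * x ^+ 2) (q / 2 * (2 * x)).
    apply: is_deriveZ.
    have := @is_deriveX R R id 2 x 1 1 (is_derive_id _ _).
    by rewrite /= expr1 /GRing.scale/= mulr1; apply.
  rewrite (_ : p + q * x = p * 1 + q / 2 * (2 * x)); last by field.
  exact: is_deriveD h1 h2.
rewrite (@continuous_FTC2 _ (fun x => p + q * x) F)//.
- by rewrite -EFinB /F; congr EFin; field.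
- by apply: continuous_subspaceT.
- split.
  + by move=> x _; case: (dF x).
  + apply: cvg_at_right_filter; apply/differentiable_continuous/derivable1_diffP.
    by case: (dF a).
  + apply: cvg_at_left_filter; apply/differentiable_continuous/derivable1_diffP.
    by case: (dF b).
- by move=> x _; rewrite derive1E; case: (dF x).
Qed.

(** A quarter of an open l1 ball, on the side of the corner that faces the tile; l1 because the
    inversion mass near a corner is to first order the sum of the two coordinate distances. *)
Definition corner_triangle (b : bool) (c1 c2 r : R) : set (R * R) :=
  if b then [set w | [/\ w.1 < c1, w.2 < c2 & (c1 - w.1) + (c2 - w.2) < r]]
  else [set w | [/\ c1 < w.1, c2 < w.2 & (w.1 - c1) + (w.2 - c2) < r]].

Lemma measurable_corner_triangle b c1 c2 r :
  measurable (corner_triangle b c1 c2 r).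
Proof.
have h (a : R) : measurable [set w : R * R | w.1 + w.2 < a].
  rewrite -[X in measurable X]setTI.
  rewrite (_ : [set w : R * R | w.1 + w.2 < a] =
    (fun w => w.1 + w.2) @^-1` `]-oo, a[); last first.
    by apply/seteqP; split => w /=; rewrite in_itv.
  apply: (measurable_funD measurable_fst measurable_snd) => //.
have h' (a : R) : measurable [set w : R * R | a < w.1 + w.2].
  rewrite -[X in measurable X]setTI.
  rewrite (_ : [set w : R * R | a < w.1 + w.2] =
    (fun w => w.1 + w.2) @^-1` `]a, +oo[); last first.
    by apply/seteqP; split => w /=; rewrite in_itv/= andbT.
  apply: (measurable_funD measurable_fst measurable_snd) => //.
case: b.
  rewrite (_ : corner_triangle _ _ _ _ = [set w | w.1 < c1] `&`
    ([set w | w.2 < c2] `&` [set w | c1 + c2 - r < w.1 + w.2])).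
    by apply: measurableI; [exact: measurable_lt_fst|apply: measurableI];
      [exact: measurable_lt_snd|exact: h'].
  by apply/seteqP; split => w /=; [case=> ? ? ?|case=> ? [? ?]]; split => //; lra.
rewrite (_ : corner_triangle _ _ _ _ = [set w | c1 < w.1] `&`
  ([set w | c2 < w.2] `&` [set w | w.1 + w.2 < c1 + c2 + r])).
  by apply: measurableI; [exact: measurable_gt_fst|apply: measurableI];
    [exact: measurable_gt_snd|exact: h].
by apply/seteqP; split => w /=; [case=> ? ? ?|case=> ? [? ?]]; split => //; lra.
Qed.

Lemma area_corner_triangle b c1 c2 r : 0 < r ->
  (lambda \x lambda)%E (corner_triangle b c1 c2 r) = (r ^+ 2 / 2)%:E.
Proof.
move=> r0; rewrite /product_measure1.
(* The vertical section at abscissa [x] in []a1, b1[] is an interval of length [p + q * x]. *)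
pose a1 := if b then c1 - r else c1; pose b1 := if b then c1 else c1 + r.
pose p := if b then r - c1 else r + c1; pose q : R := if b then 1 else -1.
transitivity (\int[lambda]_(x in `]a1, b1[) (p + q * x)%:E)%E; last first.
  rewrite integral_affine; last by rewrite /a1 /b1; case: (b); lra.
  by congr EFin; rewrite /a1 /b1 /p /q; case: (b); field.
rewrite [RHS]integral_mkcond; apply: eq_integral => x _ /=.
rewrite patchE; case: ifPn => [|nx].
  rewrite inE /= in_itv/= => hx.
  have -> : xsection (corner_triangle b c1 c2 r) x =
      if b then `]c2 - (r - (c1 - x)), c2[%classic
      else `]c2, c2 + (r - (x - c1))[%classic.
    apply/seteqP; split => y; rewrite /xsection/= inE /corner_triangle;
    move: hx; rewrite /a1 /b1; case: (b) => hx /=; rewrite in_itv/=.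
    + by case=> ? ? ?; lra.
    + by case=> ? ? ?; lra.
    + by move=> ?; split; lra.
    + by move=> ?; split; lra.
  move: hx; rewrite /a1 /b1 /p /q; case: (b) => hx;
    rewrite lebesgue_measure_itv/= lte_fin.
    by rewrite ifT; [rewrite -EFinB; congr EFin; ring|lra].
  by rewrite ifT; [rewrite -EFinB; congr EFin; ring|lra].
rewrite (_ : xsection _ x = set0) ?measure0//.
apply/seteqP; split => // y; rewrite /xsection/= inE => h.
move/negP: nx; apply; rewrite inE/= in_itv/=.
by move: h; rewrite /corner_triangle /a1 /b1; case: (b) => -[/= ? ? ?]; lra.
Qed.

End TriangleArea.

(** * Comparison of mass and area through a positive density *)

Section Density.
Context (R : realType) (mu : probability (R * R)%type R).
Context (S : set (R * R)) (f : R * R -> R).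
Hypothesis mS : measurable S.
Hypothesis f_density : is_density_on mu S f.
Hypothesis f_gt0 : forall z, S z -> 0 < f z.
Local Notation lambda2 := (@lebesgue_measure R \x @lebesgue_measure R)%E.

Let measurable_density A : measurable A -> A `<=` S ->
  measurable_fun A (fun z => (f z)%:E).
Proof.
move=> mA AS; apply/measurable_EFinP; have [mf _] := f_density.
exact: measurable_funS mf.
Qed.

Let densityE A : measurable A -> A `<=` S ->
  mu A = (\int[lambda2]_(z in A) (f z)%:E)%E.
Proof. by move=> mA AS; have [_ /(_ A mA)] := f_density; rewrite setIidl. Qed.

Lemma density_le A (M : R) : measurable A -> A `<=` S ->
  (forall z, A z -> f z <= M) -> (mu A <= M%:E * lambda2 A)%E.
Proof.
move=> mA AS fM; rewrite densityE// -integral_cst//.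
apply: ge0_le_integral => //.
- by move=> z /AS/f_gt0/ltW; rewrite lee_fin.
- exact: measurable_density.
Qed.

Lemma density_ge A (M : R) : measurable A -> A `<=` S -> 0 <= M ->
  (forall z, A z -> M <= f z) -> (M%:E * lambda2 A <= mu A)%E.
Proof.
move=> mA AS M0 fM; rewrite densityE// -integral_cst//.
apply: ge0_le_integral => //.
exact: measurable_density.
Qed.

(** If the mass were zero, the density would vanish almost everywhere on [A]; being strictly
    positive there, it would force [A] to be Lebesgue null. *)
Lemma density_mass_gt0 A : measurable A -> A `<=` S ->
  (0 < lambda2 A)%E -> 0 < mass mu A.
Proof.
move=> mA AS L0; rewrite lt_neqAle mass_ge0 andbT.
apply: contraTneq L0 => A0.
rewrite -leNgt; have : mu A = 0%E by rewrite massE// -A0.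
rewrite densityE// => int0.
have absint0 : (\int[lambda2]_(z in A) `|(f z)%:E| = 0)%E.
  rewrite -[RHS]int0; apply: eq_integral => z; rewrite inE => /AS/f_gt0 h.
  by rewrite gee0_abs// lee_fin ltW.
have [+ _] := ae_eq_integral_abs lambda2 mA (measurable_density mA AS).
move=> /(_ absint0) [N [mN N0 AN]].
rewrite -N0; apply: le_measure; rewrite ?inE// => z Az; apply: AN => /=.
by move=> /(_ Az)[] fz0; have := f_gt0 (AS _ Az); rewrite fz0 ltxx.
Qed.

End Density.

(** The minimum of finitely many radii; its default 1 keeps it positive when [I] is empty. *)
Lemma finite_common_radius (R : realType) (I : finType) (Q : I -> R -> Prop) :
  (forall i, exists2 e, 0 < e & forall r, 0 < r -> r <= e -> Q i r) ->
  exists2 e, 0 < e & forall r, 0 < r -> r <= e -> forall i, Q i r.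
Proof.
move=> H; pose e i := projT1 (cid2 (H i)).
have e0 i : 0 < e i by rewrite /e; case: cid2.
have eQ i r : 0 < r -> r <= e i -> Q i r by rewrite /e; case: cid2 => ? ? /=; exact.
exists (\big[Num.min/1]_i e i); first exact: lt_bigmin.
move=> r r0 re i; apply: eQ => //; apply: le_trans re _.
exact: bigmin_le_cond.
Qed.

(** * Inversion masses and triangle masses near the corners of the tiles *)

Section CornerEstimates.
Context (R : realType) (k : nat) (t : tiling R k).
Context (mu : probability (R * R)%type R) (f : 'I_k -> R * R -> R).
Hypothesis permu : is_permuton mu.
Hypothesis mu_supp : mu (\bigcup_l tile t l) = 1%E.
Hypothesis f_density : forall l, is_density_on mu (tile t l) (f l).
Hypothesis f_gt0 : forall l z, tile t l z -> 0 < f l z.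
Hypothesis f_bl : forall l, continuous_at_within (tile t l) (bottom_left t l) (f l).
Hypothesis f_tr : forall l, continuous_at_within (tile t l) (top_right t l) (f l).
Local Notation x := (tile_x t).
Local Notation y := (tile_y t).
Local Notation side := (tile_side t).
Local Notation lambda2 := (@lebesgue_measure R \x @lebesgue_measure R)%E.

Definition corner l (b : bool) : R * R :=
  if b then top_right t l else bottom_left t l.

Lemma tile_corner l b : tile t l (corner l b).
Proof.
have s0 := tile_side_gt0 t l.
by case: b; split => /=; rewrite in_itv/=; lra.
Qed.

Lemma density_near_corner l b (e : R) : 0 < e ->
  exists2 eta, 0 < eta & forall z, tile t l z ->
    corner_x t l b z < eta -> corner_y t l b z < eta ->
    f l (corner l b) - e < f l z < f l (corner l b) + e.
Proof.
move=> e0.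
have : continuous_at_within (tile t l) (corner l b) (f l).
  by case: b; [exact: f_tr|exact: f_bl].
move=> /cvgrPdist_lt /(_ e e0); rewrite /within/=.
move=> -[[A B]/= [/nbhs_ballP[e1 /= e10 hA] /nbhs_ballP[e2 /= e20 hB]] h].
exists (Num.min e1 e2); first by rewrite lt_min e10.
move=> z zl; rewrite !lt_min => /andP[zx1 _] /andP[_ zy2].
have [/=] := zl; rewrite !in_itv/= => z1 z2.
have := h z _ zl; rewrite ltr_distlC => -> //.
have [c1 c2] : `|(corner l b).1 - z.1| < e1 /\ `|(corner l b).2 - z.2| < e2.
  rewrite !ltr_norml; move: zx1 zy2; rewrite /corner_x /corner_y /corner.
  by case: (b) => /= ? ?; split; lra.
by split; [exact: hA|exact: hB].
Qed.

Definition triangle l b r := corner_triangle b (corner l b).1 (corner l b).2 r.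

Lemma triangleP l b r z : triangle l b r z <->
  [/\ 0 < corner_x t l b z, 0 < corner_y t l b z &
      corner_x t l b z + corner_y t l b z < r].
Proof.
rewrite /triangle /corner_triangle /corner /corner_x /corner_y.
by case: b => /=; split => -[? ? ?]; split; lra.
Qed.

Lemma triangle_tile_int l b r : r <= side l -> triangle l b r `<=` tile_int t l.
Proof.
move=> rs z /triangleP; rewrite /corner_x /corner_y.
by case: b => -[? ? ?]; split; lra.
Qed.

Lemma measurable_triangle l b r : measurable (triangle l b r).
Proof. exact: measurable_corner_triangle. Qed.

(** On a small triangle the density is within [e] of its corner value, and the area is
    [r ^ 2 / 2]. *)
Lemma mass_triangle l b (e : R) : 0 < e ->
  exists2 rho, 0 < rho & forall r, 0 < r -> r <= rho ->
    `|mass mu (triangle l b r) - f l (corner l b) / 2 * r ^+ 2| <= e * r ^+ 2.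
Proof.
move=> e0; have [eta eta0 h] := density_near_corner l b e0.
have s0 := tile_side_gt0 t l.
exists (Num.min eta (side l)); first by rewrite lt_min eta0.
move=> r r0; rewrite le_min => /andP[re rs].
have mT := measurable_triangle l b r.
have Tt : triangle l b r `<=` tile t l.
  by move=> z /(triangle_tile_int rs)/tile_int_tile.
have area : lambda2 (triangle l b r) = (r ^+ 2 / 2)%:E by exact: area_corner_triangle.
set c := f l (corner l b) in h *.
have hc z : triangle l b r z -> c - e < f l z < c + e.
  move=> Tz; apply: h; [exact: Tt|move/triangleP: Tz => -[]; lra..].
have r2 : 0 < r ^+ 2 by rewrite exprn_gt0.
have up : mass mu (triangle l b r) <= (c + e) * (r ^+ 2 / 2).
  rewrite -lee_fin -massE// EFinM -area.
  by apply: (density_le (measurable_tile t l) (f_density l) (@f_gt0 l)) => // z /hc; lra.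
have lo : (c - e) * (r ^+ 2 / 2) <= mass mu (triangle l b r).
  (* Comparison from below needs a nonnegative constant; if [c - e] is negative, nonnegativity of
     the mass is enough. *)
  have [ce|ce] := ltP (c - e) 0.
    by apply: le_trans (mass_ge0 _ _); nra.
  rewrite -lee_fin -massE// EFinM -area.
  by apply: (density_ge (measurable_tile t l) (f_density l)) => // z /hc; lra.
by rewrite ler_norml; apply/andP; split; lra.
Qed.

(** Close to the corner the density is at most its corner value plus 1. The box mass is thus
    quadratic in the distances, negligible against their sum. *)
Lemma mass_corner_box l b : exists2 rho, 0 < rho & forall z, tile t l z ->
  corner_x t l b z <= rho -> corner_y t l b z <= rho ->
  mass mu (corner_box t l b z) <=
  (f l (corner l b) + 1) * (corner_x t l b z * corner_y t l b z).
Proof.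
have [eta eta0 h] := density_near_corner l b ltr01.
exists (eta / 2); first by rewrite divr_gt0.
move=> z zl zx zy.
have mB := measurable_corner_box t l b z.
set c := f l (corner l b) in h *.
have hB w : corner_box t l b z w -> f l w <= c + 1.
  by move=> [/tile_int_tile wl [wx wy]]; have := h w wl; lra.
have Bt : corner_box t l b z `<=` tile t l by move=> w [/tile_int_tile].
have c0 : 0 < c by apply: f_gt0; exact: tile_corner.
have [/=] := zl; rewrite !in_itv/= => z1 z2.
rewrite -lee_fin -massE//.
apply: le_trans (density_le (measurable_tile t l) (f_density l) (@f_gt0 l) mB Bt hB) _.
rewrite [leRHS]EFinM lee_pmul2l ?lte_fin//; last lra.
pose Q := if b then `[z.1, x l + side l] `*` `[z.2, y l + side l]
  else `[x l, z.1] `*` `[y l, z.2].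
have mQ : measurable Q by rewrite /Q; case: (b); exact: measurableX.
apply: (@le_trans _ _ (lambda2 Q)).
  apply: le_measure; rewrite ?inE// => w [[w1 w2]].
  rewrite /corner_x /corner_y /Q; case: (b) => -[/= ? ?]; split;
  by rewrite /= in_itv/=; lra.
rewrite /Q /corner_x /corner_y; case: (b); rewrite product_measure1E//=.
  rewrite !lebesgue_measure_itv/= !lte_fin.
  case: ltP => h1; last by rewrite mul0e lee_fin mulr_ge0//; lra.
  case: ltP => h2; last by rewrite mule0 lee_fin mulr_ge0//; lra.
  by rewrite -!EFinB -EFinM.
rewrite !lebesgue_measure_itv/= !lte_fin.
case: ltP => h1; last by rewrite mul0e lee_fin mulr_ge0//; lra.
case: ltP => h2; last by rewrite mule0 lee_fin mulr_ge0//; lra.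
by rewrite -!EFinB -EFinM.
Qed.

Lemma mass_open_box_gt0 l (a b c d : R) : a < b -> c < d ->
  x l <= a -> b <= x l + side l -> y l <= c -> d <= y l + side l ->
  0 < mass mu [set w | a < w.1 < b /\ c < w.2 < d].
Proof.
move=> ab cd xa bx yc dy.
have mA : measurable [set w : R * R | a < w.1 < b /\ c < w.2 < d].
  by apply: measurableI; [exact: measurable_between_fst|exact: measurable_between_snd].
apply: (density_mass_gt0 (measurable_tile t l) (f_density l) (@f_gt0 l)) => //.
  by move=> w [? ?]; split; rewrite /= in_itv/=; lra.
rewrite (_ : [set w | _] = `]a, b[ `*` `]c, d[); last first.
  by apply/seteqP; split => w [] /=; rewrite !in_itv.
rewrite product_measure1E//= !lebesgue_measure_itv/= !lte_fin ab cd.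
by rewrite -!EFinB -EFinM lte_fin mulr_gt0// subr_gt0.
Qed.

Lemma splittingsP l :
  l \in splittings t = (perm_inversions (tiling_perm t) l == finset.set0).
Proof. by rewrite inE. Qed.

(** Three regimes. A tile with inversions gives at least the side of an inverted tile. Near the
    bottom-left or top-right corner of a splitting tile, the l1-distance dominates the quadratic box
    term. Elsewhere in it, the top-left and bottom-right boxes give a positive constant. *)
Lemma inverted_mass_off_triangles (kappa : R) : 0 < kappa -> kappa < 1 ->
  exists2 rho, 0 < rho & forall r, 0 < r -> r <= rho ->
    forall l z, tile_int t l z ->
    (l \in splittings t -> forall b, ~ triangle l b r z) ->
    (1 - kappa) * r <= mass mu (inverted z).
Proof.
move=> k0 k1; apply: finite_common_radius => l.
have s0 := tile_side_gt0 t l.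
case: (boolP (l \in splittings t)); rewrite splittingsP => lD; last first.
  have [m hm] := inversion_mass_ge_side lD.
  exists (side m); first exact: tile_side_gt0.
  move=> r r0 rm z /tile_int_tile zl _.
  have := inversion_mass_le permu mu_supp zl; nra.
have [rho rho0 hrho] : exists2 rho, 0 < rho & forall b z, tile t l z ->
    corner_x t l b z <= rho -> corner_y t l b z <= rho ->
    (1 - kappa) * (corner_x t l b z + corner_y t l b z) <= mass mu (inverted z).
  have H b : exists2 rho, 0 < rho & forall r, 0 < r -> r <= rho ->
      forall z, tile t l z ->
      corner_x t l b z <= r -> corner_y t l b z <= r ->
      (1 - kappa) * (corner_x t l b z + corner_y t l b z) <= mass mu (inverted z).
    have [rho rho0 h] := mass_corner_box l b.
    set c := f l (corner l b) in h.
    have c0 : 0 < c by apply: f_gt0; exact: tile_corner.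
    (* With this radius twice the box mass is at most [kappa] times one coordinate distance, which
       is the loss allowed. *)
    exists (Num.min rho (kappa / (2 * (c + 1)))).
      by rewrite lt_min rho0 divr_gt0//; lra.
    move=> r r0; rewrite le_min => /andP[rrho rk] z zl zx zy.
    have hb := h z zl (le_trans zx rrho) (le_trans zy rrho).
    have hi := inverted_mass_ge permu mu_supp b zl.
    apply: le_trans _ hi.
    have [/=] := zl; rewrite !in_itv/= => z1 z2.
    have ux : 0 <= corner_x t l b z by rewrite /corner_x; case: (b); lra.
    have uy : 0 <= corner_y t l b z by rewrite /corner_y; case: (b); lra.
    move: rk; rewrite ler_pdivlMr; last lra.
    set u := corner_x _ _ _ _ in zx hb ux *; set v := corner_y _ _ _ _ in zy hb uy *.
    move=> rk.
    have huv : u * v <= r * v by rewrite ler_wpM2r.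
    have : 2 * ((c + 1) * (u * v)) <= kappa * v.
      apply: (@le_trans _ _ (2 * ((c + 1) * (r * v)))).
        by rewrite ler_wpM2l// ler_wpM2l//; lra.
      have -> : 2 * ((c + 1) * (r * v)) = r * (2 * (c + 1)) * v by ring.
      by rewrite ler_wpM2r.
    have : 0 <= kappa * u by rewrite mulr_ge0// ltW.
    lra.
  have [rho rho0 h] := finite_common_radius H.
  by exists rho => // b z; exact: h.
(* Near means within [eta] of a corner in both coordinates; a third of the side ensures
   [2 * eta < side l], as the argument with boxes requires. *)
pose eta := Num.min rho (side l / 3).
have eta0 : 0 < eta by rewrite lt_min rho0 divr_gt0.
have etarho : eta <= rho by rewrite ge_min lexx.
have etas : 2 * eta < side l.
  have : eta <= side l / 3 by rewrite ge_min lexx orbT.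
  lra.
pose c := Num.min (mass mu (NW_box t l eta)) (mass mu (SE_box t l eta)).
have c0 : 0 < c.
  by rewrite lt_min; apply/andP; split; apply: (@mass_open_box_gt0 l); lra.
exists c => // r r0 rc z zint nT.
have zl := tile_int_tile zint.
have [near|far] := pselect (exists b, corner_x t l b z <= eta /\ corner_y t l b z <= eta).
  have [b [bx byy]] := near.
  apply: le_trans (hrho b z zl (le_trans bx etarho) (le_trans byy etarho)).
  rewrite ler_pM2l; last lra.
  rewrite leNgt; apply/negP => lt_r.
  apply: (nT isT b); apply/triangleP; split => //.
    by move: zint; rewrite /corner_x => -[]; case: (b); lra.
  by move: zint; rewrite /corner_y => -[]; case: (b); lra.
apply: (@le_trans _ _ c); first by nra.
apply: (inverted_mass_ge_boxes zl etas).
- by rewrite ge_min lexx.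
- by rewrite ge_min lexx orbT.
- move=> b; case: (ltP eta (corner_x t l b z)) => hx; [by left|right].
  by rewrite ltNge; apply/negP => hy; apply: far; exists b.
Qed.

Definition corner_region (r : R) : set (R * R) :=
  \bigcup_(lb in [set lb | lb.1 \in splittings t]) triangle lb.1 lb.2 r.

Lemma measurable_corner_region r : measurable (corner_region r).
Proof.
apply: fin_bigcup_measurable => // lb _; exact: measurable_triangle.
Qed.

(** Once [r] is at most every side, the triangles are disjoint and their masses add; the error is
    shared among the corners. *)
Lemma mass_corner_region (e : R) : 0 < e ->
  exists2 rho, 0 < rho & forall r, 0 < r -> r <= rho ->
    `|mass mu (corner_region r) -
      (\sum_(l in splittings t)
         (f l (bottom_left t l) + f l (top_right t l)) / 2) * r ^+ 2|
    <= e * r ^+ 2.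
Proof.
move=> e0.
(* The added 1 keeps [N] positive for an empty index type. *)
pose N : R := #|{: 'I_k * bool}|%:R + 1.
have N0 : 0 < N by rewrite ltr_wpDl.
have [rho rho0 h] := finite_common_radius
  (fun lb : 'I_k * bool => mass_triangle lb.1 lb.2 (divr_gt0 e0 N0)).
have [s s0 hs] : exists2 s, 0 < s & forall r, 0 < r -> r <= s -> forall l, r <= side l.
  apply: finite_common_radius => l; exists (side l) => //; exact: tile_side_gt0.
exists (Num.min rho s); first by rewrite lt_min rho0.
move=> r r0; rewrite le_min => /andP[rrho rs].
have {}rs := hs r r0 rs; have {}h := h r r0 rrho.
have -> : \sum_(l in splittings t)
    (f l (bottom_left t l) + f l (top_right t l)) / 2 =
  \sum_(lb : 'I_k * bool | lb.1 \in splittings t) f lb.1 (corner lb.1 lb.2) / 2.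
  transitivity (\sum_(l in splittings t) \sum_(b : bool) f l (corner l b) / 2).
    by apply: eq_bigr => l _; rewrite big_bool /= mulrDl addrC.
  by rewrite pair_big_dep/=; apply: eq_bigl => lb; rewrite andbT.
rewrite (@sum_mass_disjoint _ _ _ _ _ [pred lb : 'I_k * bool | lb.1 \in splittings t]
  _ (fun lb => triangle lb.1 lb.2 r)); last 3 first.
- by move=> lb _; exact: measurable_triangle.
- move=> [l b] [l' b'] w /= _ _ wT wT'.
  have wl := triangle_tile_int (rs l) wT; have wl' := triangle_tile_int (rs l') wT'.
  have ll' := tile_int_inj wl wl'; subst l'.
  (* The l1-distances to opposite corners of a tile add up to twice its side, so they cannot both be
     below [r]. *)
  have -> : b = b'; last by [].
  move: wT wT' (rs l) => /triangleP + /triangleP; rewrite /corner_x /corner_y.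
  by case: (b); case: (b') => // -[? ? ?] -[? ? ?] ?; exfalso; lra.
- by move=> w; split => -[lb ? ?]; exists lb.
rewrite mulr_suml -sumrB.
apply: le_trans (ler_norm_sum _ _ _) _.
apply: (@le_trans _ _ (\sum_(lb : 'I_k * bool) e / N * r ^+ 2)).
  rewrite big_mkcond/=; apply: ler_sum => lb _; case: ifP => _; first exact: h.
  by rewrite mulr_ge0 ?sqr_ge0// divr_ge0// ltW.
rewrite sumr_const -[leLHS]mulr_natl mulrA ler_wpM2r ?sqr_ge0//.
rewrite mulrCA ger_pMr// ler_pdivrMr// mul1r /N; lra.
Qed.

End CornerEstimates.

(** * Limit theorems *)

Section Rayleigh.
Context (R : realType) (b : R).

(** Inverse transform: a uniform [u] is read as a survival probability, and
    [expR (- (b * s ^ 2)) = u] is solved for [s]. *)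
Definition rayleigh_quantile (u : measurableTypeR R) : R :=
  Num.sqrt (- ln (u : R) / b).

Lemma measurable_rayleigh_quantile :
  measurable_fun [set: measurableTypeR R] rayleigh_quantile.
Proof.
have msqrt : measurable_fun [set: R] (@Num.sqrt R).
  apply: continuous_measurable_fun => u; exact: sqrt_continuous.
apply: (measurableT_comp msqrt).
apply: measurable_funM; last exact: measurable_cst.
by apply: measurableT_comp => //; exact: measurable_ln.
Qed.

HB.instance Definition _ := isMeasurableFun.Build _ _ _ _
  rayleigh_quantile measurable_rayleigh_quantile.

Lemma rayleigh_exists : 0 < b -> exists nu : probability R R, is_rayleigh nu 2 b.
Proof.
move=> b0; exists (distribution (uniform_prob (@ltr01 R)) rayleigh_quantile).
have mq A : measurable A -> measurable (rayleigh_quantile @^-1` A).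
  by move=> mA; rewrite -[_ @^-1` _]setTI; exact: measurable_rayleigh_quantile.
split.
  rewrite -[LHS]/(uniform_prob (@ltr01 R) (rayleigh_quantile @^-1` `[0, +oo[)).
  rewrite (_ : _ @^-1` _ = setT); first exact: probability_setT.
  by apply/seteqP; split => u //= _; rewrite in_itv/= sqrtr_ge0.
move=> s s0.
rewrite -[LHS]/(uniform_prob (@ltr01 R) (rayleigh_quantile @^-1` `]s, +oo[)).
apply: etrans (uniform_prob01E _) _; first exact: mq.
have bs0 : 0 <= b * s ^+ 2 by rewrite mulr_ge0 ?sqr_ge0// ltW.
have e1 : expR (- (b * s ^+ 2)) <= 1.
  by rewrite -[leRHS]expR0 ler_expR oppr_le0.
have key u : 0 < u -> (s < rayleigh_quantile u) = (u < expR (- (b * s ^+ 2))).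
  move=> u0; rewrite -{2}[u](@lnK R) ?posrE// ltr_expR.
  rewrite /rayleigh_quantile -{1}[s]ger0_norm// -sqrtr_sqr.
  have [q0|q0] := ltP 0 (- ln u / b).
    by rewrite ltr_sqrt// ltr_pdivlMr// mulrC ltrNr.
  (* Here [u >= 1]: the square root of a nonpositive number is 0, and both inequalities fail. *)
  rewrite (ler0_sqrtr q0) ltNge sqrtr_ge0/=; apply/esym/negbTE; rewrite -leNgt.
  move: q0; rewrite ler_pdivrMr// mul0r; lra.
rewrite (_ : _ `&` _ = `]0, expR (- (b * s ^+ 2))[%classic).
  rewrite lebesgue_measure_itv/= lte_fin expR_gt0 oppr0 adde0.
  by rewrite -[2]/(2%:R) powR_mulrn.
apply/seteqP; split => u /=; rewrite !in_itv/= ?andbT.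
  move=> [su /andP[u0 u1]].
  (* At [u = 0] the convention [ln 0 = 0] makes the quantile 0, which does not exceed [s]. *)
  have u0' : 0 < u.
    rewrite lt_neqAle u0 andbT; apply: contraTneq su => <-.
    by rewrite /rayleigh_quantile ln0// oppr0 mul0r sqrtr0 -leNgt.
  by rewrite -key// su u0'.
by move=> /andP[u0 ue]; rewrite key// ue; split => //; lra.
Qed.

(** The maximum with 0 yields one continuous formula that also covers negative [r]. *)
Lemma rayleigh_cdf (nu : probability R R) (r : R) : 0 < b ->
  is_rayleigh nu 2 b ->
  nu `]-oo, r]%classic = (1 - expR (- (b * Num.max 0 r ^+ 2)))%:E.
Proof.
move=> b0 [nu0 nut].
have [r0|r0] := leP 0 r.
  rewrite -[X in nu X]setCK probability_setC; last exact: measurableC.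
  by rewrite setCitvl nut// -[2]/(2%:R) powR_mulrn// -EFinB.
rewrite expr0n/= mulr0 oppr0 expR0 subrr; apply/eqP; rewrite -measure_le0.
rewrite -[leRHS](_ : nu (~` `[0, +oo[%classic) = 0%E).
  apply: le_measure; rewrite ?inE//; first exact: measurableC.
  by move=> u /=; rewrite !in_itv/= andbT => ur; apply/negP; rewrite -ltNge; lra.
by rewrite probability_setC// nu0 subee.
Qed.

End Rayleigh.

Lemma cvg_sqrt_natr (R : realType) (a : R) : a / Num.sqrt n%:R @[n --> \oo] --> 0.
Proof.
rewrite -[X in _ --> X](mulr0 a); apply: cvgM; first exact: cvg_cst.
apply/gtr0_cvgV0.
  by near=> n; rewrite sqrtr_gt0 ltr0n; near: n; exact: nbhs_infty_gt.
apply/cvgryPge => A; near=> n.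
apply: (@le_trans _ _ (Num.sqrt (A ^+ 2))); first by rewrite sqrtr_sqr ler_norm.
rewrite ler_wsqrtr//; near: n; exact: nbhs_infty_ger.
Unshelve. all: by end_near. Qed.

(** Squeeze between the powers of [expR (- p / (1 - p)) <= 1 - p <= expR (- p)]; convergence of
    [n * p n] forces [p n] to 0. *)
Lemma cvg_expr_poisson (R : realType) (p : nat -> R) (c : R) :
  (forall n, 0 <= p n <= 1) -> n%:R * p n @[n --> \oo] --> c ->
  (1 - p n) ^+ n @[n --> \oo] --> expR (- c).
Proof.
move=> p01 npc.
have p0 : p n @[n --> \oo] --> 0.
  have : n%:R^-1 * (n%:R * p n) @[n --> \oo] --> 0.
    rewrite -[X in _ --> X](mul0r c); apply: cvgM npc.
    apply/gtr0_cvgV0; last exact: cvgr_idn.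
    by near=> n; rewrite ltr0n; near: n; exact: nbhs_infty_gt.
  apply: cvg_trans; apply: near_eq_cvg; near=> n.
  rewrite mulKf// pnatr_eq0 -lt0n; near: n; exact: nbhs_infty_gt.
apply: (@squeeze_cvgr _ _ _ _ (fun n => expR (- (n%:R * p n * (1 - p n)^-1)))
  (fun n => expR (- (n%:R * p n)))).
- near=> n.
  have p1 : p n < 1 by near: n; exact: (cvgr_lt 0).
  have /andP[pn0 _] := p01 n.
  have q0 : 0 < 1 - p n by rewrite subr_gt0.
  apply/andP; split.
    rewrite -mulrA -mulrN expRM_natl lerXn2r ?nnegrE ?expR_ge0//; first lra.
    have e1 : 1 - p n = (1 + p n * (1 - p n)^-1)^-1.
      by field; rewrite ?gt_eqF//; lra.
    rewrite [leRHS]e1 expRN lef_pV2 ?posrE ?expR_gt0//; first exact: expR_ge1Dx.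
    by rewrite ltr_wpDr// mulr_ge0// invr_ge0 ltW.
  rewrite -mulrN expRM_natl lerXn2r ?nnegrE ?expR_ge0//; first lra.
  exact: expR_ge1Dx.
- apply: continuous_cvg; first exact: continuous_expR.
  apply: cvgN; rewrite -[X in _ --> X]mulr1; apply: cvgM npc _.
  rewrite -[X in _ --> X]invr1; apply: cvgV; first exact: oner_neq0.
  by rewrite -[X in _ --> X]subr0; apply: cvgB p0; exact: cvg_cst.
- apply: continuous_cvg; first exact: continuous_expR.
  exact: cvgN.
Unshelve. all: by end_near. Qed.

(** The probabilistic bounds may shift the argument a little; continuity of the limit makes the
    shift harmless. *)
Lemma cvg_sandwich (R : realType) (F : nat -> R) (Phi : R -> R) (s : R) :
  {for s, continuous Phi} ->
  (forall a e, s < a -> 0 < e -> \forall n \near \oo, F n <= Phi a + e) ->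
  (forall a e, a < s -> 0 < e -> \forall n \near \oo, Phi a - e <= F n) ->
  F n @[n --> \oo] --> Phi s.
Proof.
move=> cPhi hi lo; apply/cvgrPdist_le => e e0.
have e20 : 0 < e / 2 by rewrite divr_gt0.
have /cvgrPdist_le /(_ _ e20) := cPhi.
move=> /nbhs_ballP[d /= d0 hd].
have d20 : 0 < d / 2 by rewrite divr_gt0.
have h1 : `|Phi s - Phi (s + d / 2)| <= e / 2.
  by apply: hd; rewrite /ball/= ltr_norml; lra.
have h2 : `|Phi s - Phi (s - d / 2)| <= e / 2.
  by apply: hd; rewrite /ball/= ltr_norml; lra.
rewrite !ler_norml in h1 h2; near=> n.
have h3 : F n <= Phi (s + d / 2) + e / 2.
  by near: n; apply: hi => //; lra.
have h4 : Phi (s - d / 2) - e / 2 <= F n.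
  by near: n; apply: lo => //; lra.
rewrite ler_norml; lra.
Unshelve. all: by end_near. Qed.

Lemma min_inversion_le (R : realType) n (z : 'I_n -> R * R) i :
  (min_inversion z <= #|point_inversions z i|)%N.
Proof.
rewrite /min_inversion; elim: (index_enum _) (mem_index_enum i) => //= j s IH.
rewrite inE big_cons => /orP[/eqP <-|/IH h]; first exact: geq_minl.
exact: leq_trans (geq_minr _ _) h.
Qed.

Lemma lt_min_inversion (R : realType) n (z : 'I_n -> R * R) (s : R) :
  (0 < n)%N -> (forall i, s < #|point_inversions z i|%:R) ->
  s < (min_inversion z)%:R.
Proof.
move=> n0 h; apply: (big_ind (fun v => s < v%:R)) => //.
(* The default value [n] of the minimum also exceeds [s], as an inversion set has at most [n]
   elements. *)
- apply: lt_le_trans (h (Ordinal n0)) _; rewrite ler_nat.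
  by rewrite -[leqRHS]card_ord max_card.
- by move=> u v su sv; rewrite natr_min lt_min su.
Qed.

Lemma mass_hits_some d (T : measurableType d) d' (T' : measurableType d')
    (R : realType) (P : probability T R) (mu : probability T' R) n
    (Z : 'I_n -> {RV P >-> T'}) (B : set T') : iid P Z mu -> measurable B ->
  mass P [set w | hits Z B w != finset.set0] = 1 - (1 - mass mu B) ^+ n.
Proof.
move=> iidZ mB; rewrite -(mass_hits0 iidZ mB) -mass_setC.
  by congr (mass P _); apply/seteqP; split => w /=; [move/negP|move=> h; apply/negP].
exact: (measurable_hits Z (pred1 finset.set0)).
Qed.

Lemma sqrt_natr_le (R : realType) n : Num.sqrt n%:R <= n%:R :> R.
Proof.
case: (posnP n) => [->|n0]; first by rewrite sqrtr0.
have n1 : 1 <= n%:R :> R by rewrite ler1n.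
by rewrite -[leRHS]ger0_norm// -sqrtr_sqr ler_wsqrtr// expr2 ler_peMr.
Qed.

(** * Limits of the minimal inversion of the sample *)

Section Limits.
Context (R : realType) (k : nat) (t : tiling R k)
  (mu : probability (R * R)%type R) (f : 'I_k -> R * R -> R).
Hypothesis mu_permuton : is_permuton mu.
Hypothesis mu_supp : mu (\bigcup_l tile t l) = 1%E.
Hypothesis f_density : forall l, is_density_on mu (tile t l) (f l).
Hypothesis f_gt0 : forall l z, tile t l z -> 0 < f l z.
Hypothesis f_bl : forall l, continuous_at_within (tile t l) (bottom_left t l) (f l).
Hypothesis f_tr : forall l, continuous_at_within (tile t l) (top_right t l) (f l).
Context (d : nat -> measure_display) (T : forall n, measurableType (d n))
  (P : forall n, probability (T n) R)
  (Z : forall n, 'I_n -> {RV P n >-> (R * R)%type}).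
Arguments Z : clear implicits.
Hypothesis Z_iid : forall n, iid (P n) (Z n) mu.

(** A null event, outside which every sample point lies in an open tile and the geometric bounds
    apply. *)
Let off_tiles n : set (T n) :=
  [set w | hits (Z n) (~` \bigcup_l tile_int t l) w != finset.set0].
Arguments off_tiles : clear implicits.

Let measurable_tiles : measurable (\bigcup_l tile_int t l).
Proof. by apply: fin_bigcup_measurable => // l _; exact: measurable_tile_int. Qed.

Let measurable_some n (B : set (R * R)) : measurable B ->
  measurable [set w | hits (Z n) B w != finset.set0].
Proof.
move=> mB; exact: (measurable_hits (Z n) [pred J | J != finset.set0] mB).
Qed.

Let measurable_off_tiles n : measurable (off_tiles n).
Proof. exact/measurable_some/measurableC. Qed.

Let mass_off_tiles n : mass (P n) (off_tiles n) = 0.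
Proof.
rewrite (mass_hits_some (Z_iid n)); last exact: measurableC.
by rewrite mass_setC// (mass_tiles_int mu_permuton mu_supp) subrr subr0 expr1n subrr.
Qed.

Let on_tiles n w : ~ off_tiles n w -> forall i, exists l, tile_int t l (Z n i w).
Proof.
move=> nw i; apply: contrapT => h; apply: nw; apply/set0Pn; exists i.
by rewrite inE; apply/mem_set => -[l _ wl]; apply: h; exists l.
Qed.

Let tile_unit_square l z : tile_int t l z -> unit_square z.
Proof.
by have [? ? ? ?] := tile_bounds t l; move=> [? ?]; split; lra.
Qed.

Let some_hit n (B : set (R * R)) w :
  hits (Z n) B w != finset.set0 -> exists i, B (Z n i w).
Proof. by case/set0Pn => i; rewrite inE => /set_mem Bi; exists i. Qed.

Let no_hit n (B : set (R * R)) w :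
  ~ (hits (Z n) B w != finset.set0) -> forall i, ~ B (Z n i w).
Proof.
move=> h i Bi; apply: h; apply/set0Pn; exists i; rewrite inE; exact/mem_set.
Qed.

(** * Scale [sqrt n]: the Rayleigh limit *)

Section Splitting.
Let B0 := \sum_(l in splittings t)
  (f l (bottom_left t l) + f l (top_right t l)) / 2.
Let S n : T n -> R := scaled_min_inversion (Num.sqrt n%:R)^-1 (Z n).
Arguments S : clear implicits.
Let V n (a : R) : set (T n) :=
  [set w | hits (Z n) (corner_region t (a / Num.sqrt n%:R)) w != finset.set0].
Arguments V : clear implicits.

Let sqrt_bnd n : (Num.sqrt n%:R : R) <= (Num.sqrt n%:R : R) <= (n%:R : R).
Proof. by rewrite lexx sqrt_natr_le. Qed.

Let measurable_V n a : measurable (V n a).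
Proof. by apply: measurable_some; exact: measurable_corner_region. Qed.

(** The expected number of sample points in the corner region tends to [B0 * a ^ 2], so the
    probability of hitting none has the Poisson limit. *)
Let cvg_V a : 0 < a ->
  mass (P n) (V n a) @[n --> \oo] --> 1 - expR (- (B0 * a ^+ 2)).
Proof.
move=> a0.
pose p n := mass mu (corner_region t (a / Num.sqrt n%:R)).
have VE n : mass (P n) (V n a) = 1 - (1 - p n) ^+ n.
  by rewrite (mass_hits_some (Z_iid n))//; exact: measurable_corner_region.
under eq_fun do rewrite VE.
apply: cvgB; first exact: cvg_cst.
apply: cvg_expr_poisson.
  by move=> n; rewrite mass_ge0 mass_le1//; exact: measurable_corner_region.
apply/cvgrPdist_le => e e0.
have a20 : 0 < a ^+ 2 by rewrite exprn_gt0.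
(* Relative precision [e / a ^ 2] becomes [e] after multiplication by
   [n * (a / sqrt n) ^ 2 = a ^ 2]. *)
have [rho rho0 h] := mass_corner_region f_density f_gt0 f_bl f_tr (divr_gt0 e0 a20).
near=> n.
have n0 : 0 < n%:R :> R by rewrite ltr0n; near: n; exact: nbhs_infty_gt.
have r0 : 0 < a / Num.sqrt n%:R by rewrite divr_gt0// sqrtr_gt0.
have rr : a / Num.sqrt n%:R <= rho.
  by near: n; exact: (cvgr_le 0 (@cvg_sqrt_natr R a)).
have := h _ r0 rr; rewrite -/(p n) -/B0 => {}h.
have rE : (a / Num.sqrt n%:R) ^+ 2 = a ^+ 2 / n%:R.
  by rewrite expr_div_n sqr_sqrtr// ltW.
rewrite distrC; have -> : n%:R * p n - B0 * a ^+ 2 =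
    n%:R * (p n - B0 * (a / Num.sqrt n%:R) ^+ 2).
  by rewrite rE; field; rewrite gt_eqF.
rewrite normrM (ger0_norm (ltW n0)).
apply: le_trans (ler_wpM2l (ltW n0) h) _.
rewrite rE le_eqVlt; apply/orP; left; apply/eqP.
by field; rewrite !gt_eqF.
Unshelve. all: by end_near. Qed.

Let measurable_S n s : measurable [set w | S n w <= s].
Proof.
rewrite (_ : [set w | _] = S n @^-1` `]-oo, s]); last first.
  by apply/seteqP; split => w /=; rewrite in_itv.
by rewrite -[X in measurable X]setTI; apply: measurable_scaled_min_inversion.
Qed.

Let S_ge0 n w : 0 <= S n w.
Proof. by rewrite mulr_ge0// invr_ge0 sqrtr_ge0. Qed.

Let S_le n w s : (0 < n)%N ->
  (S n w <= s) = ((min_inversion (fun i => Z n i w))%:R <= s * Num.sqrt n%:R).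
Proof.
move=> n0; rewrite /S /scaled_min_inversion mulrC ler_pdivrMr//.
by rewrite sqrtr_gt0 ltr0n.
Qed.

(** If no sample point is in the triangles of size [a / sqrt n], all inversion masses times [n] are
    at least [(s + eps) * sqrt n], and concentration puts every count above [s * sqrt n]. *)
Let S_upper s a e : 0 <= s -> s < a -> 0 < e ->
  \forall n \near \oo, mass (P n) [set w | S n w <= s] <=
    1 - expR (- (B0 * a ^+ 2)) + e.
Proof.
move=> s0 sa e0; have a0 : 0 < a by lra.
pose eps := (a - s) / 2; have eps0 : 0 < eps by rewrite /eps; lra.
have [E [mE E0 hE]] := inversions_gt_whp mu_permuton Z_iid sqrt_bnd s0 eps0.
(* Chosen so that [(1 - kappa) * a] is the midpoint [s + eps] of [s] and [a]. *)
pose kappa := (a - s) / (2 * a).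
have k0 : 0 < kappa by rewrite divr_gt0//; lra.
have k1 : kappa < 1 by rewrite ltr_pdivrMr//; lra.
have kE : (1 - kappa) * a = s + eps by rewrite /kappa /eps; field; rewrite gt_eqF.
have [rho rho0 hrho] := inverted_mass_off_triangles mu_permuton mu_supp
  f_density f_gt0 f_bl f_tr k0 k1.
have e20 : 0 < e / 2 by rewrite divr_gt0.
near=> n.
have n0 : (0 < n)%N by near: n; exact: nbhs_infty_gt.
have n0' : 0 < n%:R :> R by rewrite ltr0n.
have q0 : 0 < Num.sqrt n%:R :> R by rewrite sqrtr_gt0.
have r0 : 0 < a / Num.sqrt n%:R by rewrite divr_gt0.
have rr : a / Num.sqrt n%:R <= rho.
  by near: n; exact: (cvgr_le 0 (@cvg_sqrt_natr R a)).
have hEn : mass (P n) (E n) <= e / 2 by near: n; exact: (cvgr_le 0 E0).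
have hVn : mass (P n) (V n a) <= 1 - expR (- (B0 * a ^+ 2)) + e / 2.
  by near: n; apply: (cvgr_le _ (cvg_V a0)); rewrite ltrDl.
have mON := measurableU _ _ (mE n) (measurable_off_tiles n).
have hON := le_massU (P n) mON (mE n) (measurable_off_tiles n) (@subset_refl _ _).
rewrite mass_off_tiles in hON.
apply: le_trans (le_massU (P n) (measurable_S n s) mON (measurable_V n a) _) _; last lra.
move=> w /= Sw; apply: contrapT => /not_orP[/not_orP[nE nO] nV].
move: Sw; rewrite S_le//; apply/negP; rewrite -ltNge.
apply: lt_min_inversion => // i; apply: (hE n w n0 nE i).
  by have [l /tile_unit_square] := on_tiles nO i.
have [l hl] := on_tiles nO i.
have nT : l \in splittings t -> forall b, ~ triangle t l b (a / Num.sqrt n%:R) (Z n i w).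
  by move=> lS b hT; apply: (@no_hit n (corner_region t (a / Num.sqrt n%:R)) w nV i); exists (l, b).
have := hrho _ r0 rr l (Z n i w) hl nT.
rewrite mulrA kE -(ler_pM2l n0'); apply: le_trans.
have qq : Num.sqrt n%:R * Num.sqrt n%:R = n%:R :> R by rewrite -expr2 sqr_sqrtr// ltW.
rewrite -{2}qq le_eqVlt; apply/orP; left; apply/eqP.
by field; rewrite gt_eqF.
Unshelve. all: by end_near. Qed.

(** One sample point in a triangle suffices: its tile is a splitting, so its inversion mass is below
    [a / sqrt n], and concentration with margin [s - a] keeps its count below [s * sqrt n]. *)
Let S_lower s a e : 0 < a -> a < s -> 0 < e ->
  \forall n \near \oo, 1 - expR (- (B0 * a ^+ 2)) - e <=
    mass (P n) [set w | S n w <= s].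
Proof.
move=> a0 sa e0.
have eps0 : 0 < s - a by lra.
have eps1 : s - a < s by lra.
have [E [mE E0 hE]] := inversions_lt_whp mu_permuton Z_iid sqrt_bnd eps0 eps1.
have e20 : 0 < e / 2 by rewrite divr_gt0.
have [sd sd0 hsd] : exists2 sd, 0 < sd & forall r, 0 < r -> r <= sd ->
    forall l, r <= tile_side t l.
  apply: finite_common_radius => l; exists (tile_side t l) => //.
  exact: tile_side_gt0.
near=> n.
have n0 : (0 < n)%N by near: n; exact: nbhs_infty_gt.
have n0' : 0 < n%:R :> R by rewrite ltr0n.
have q0 : 0 < Num.sqrt n%:R :> R by rewrite sqrtr_gt0.
have r0 : 0 < a / Num.sqrt n%:R by rewrite divr_gt0.
have rr : a / Num.sqrt n%:R <= sd.
  by near: n; exact: (cvgr_le 0 (@cvg_sqrt_natr R a)).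
have hEn : mass (P n) (E n) <= e / 2 by near: n; exact: (cvgr_le 0 E0).
have hVn : 1 - expR (- (B0 * a ^+ 2)) - e / 2 <= mass (P n) (V n a).
  by near: n; apply: (cvgr_ge _ (cvg_V a0)); rewrite gtrBl.
have := le_massU (P n) (measurable_V n a) (measurable_S n s) (mE n).
move=> /(_ _)/(le_trans hVn) h.
suff : V n a `<=` [set w | S n w <= s] `|` E n by move=> /h; lra.
move=> w /some_hit[i [[l b] /= lS hT]].
have [hE'|nE] := pselect (E n w); [by right|left => /=].
have wint := triangle_tile_int (hsd _ r0 rr l) hT.
rewrite S_le//.
apply: (@le_trans _ _ #|point_inversions (fun j => Z n j w) i|%:R).
  by rewrite ler_nat; exact: min_inversion_le.
apply/ltW/(hE n w n0 nE i); first exact: tile_unit_square wint.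
have := inverted_mass_le mu_permuton mu_supp b (tile_int_tile wint).
move/triangleP : hT => [_ _ hlt].
have -> : inversion_mass t l = 0.
  move: lS; rewrite splittingsP => /eqP lS.
  by rewrite /inversion_mass lS big_set0.
rewrite add0r => /le_lt_trans/(_ hlt) h1.
rewrite opprB addrC subrK.
have qq : Num.sqrt n%:R * Num.sqrt n%:R = n%:R :> R by rewrite -expr2 sqr_sqrtr// ltW.
rewrite -{1}qq -mulrA [leRHS]mulrC ler_pM2l// mulrC -ler_pdivlMr//; exact: ltW.
Unshelve. all: by end_near. Qed.

Lemma cvg_cdf_rayleigh (s : R) :
  mass (P n) [set w | S n w <= s] @[n --> \oo] -->
  1 - expR (- (B0 * Num.max 0 s ^+ 2)).
Proof.
apply: (@cvg_sandwich _ _ (fun s => 1 - expR (- (B0 * Num.max 0 s ^+ 2)))).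
- have cm : {for s, continuous (fun s : R => Num.max 0 s)}.
    by apply: (@continuous_max _ _ (fun=> 0) id); [exact: cvg_cst|exact: cvg_id].
  apply: cvgB; first exact: cvg_cst.
  apply: continuous_cvg; first exact: continuous_expR.
  apply: cvgN; apply: cvgM; first exact: cvg_cst.
  by under eq_fun do rewrite expr2; rewrite expr2; exact: cvgM.
- move=> a e sa e0; have [s0|s0] := leP 0 s.
    have -> : Num.max 0 a = a by apply/max_idPr; lra.
    exact: S_upper.
  (* For negative [s] the event is empty and the target value is nonnegative. *)
  apply: nearW => n.
  have -> : [set w | S n w <= s] = set0.
    by apply/seteqP; split => // w /= h; have := S_ge0 w; lra.
  rewrite {1}/mass measure0/=.
  have : expR (- (B0 * Num.max 0 a ^+ 2)) <= 1.
    rewrite -[leRHS]expR0 ler_expR oppr_le0 mulr_ge0 ?sqr_ge0//.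
    apply: sumr_ge0 => l _; rewrite divr_ge0// addr_ge0// ltW// f_gt0//.
      exact: (tile_corner t l false).
    exact: (tile_corner t l true).
  lra.
- move=> a e sa e0; have [a0|a0] := leP a 0.
    apply: nearW => n; rewrite expr0n/= mulr0 oppr0 expR0 subrr sub0r.
    by apply: le_trans (mass_ge0 _ _); lra.
  exact: S_lower.
Qed.

End Splitting.

(** * Scale [n]: the constant limit *)

Section Linear.
Let M := min_tiling_inversion t.
Let S n : T n -> R := scaled_min_inversion n%:R^-1 (Z n).
Arguments S : clear implicits.

Let id_bnd n : (Num.sqrt n%:R : R) <= (n%:R : R) <= (n%:R : R).
Proof. by rewrite lexx sqrt_natr_le. Qed.

Let S_lt n w s : (0 < n)%N ->
  (S n w < s) = ((min_inversion (fun i => Z n i w))%:R < s * n%:R).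
Proof.
by move=> n0; rewrite /S /scaled_min_inversion mulrC ltr_pdivrMr// ltr0n.
Qed.

Let S_gt n w s : (0 < n)%N ->
  (s < S n w) = (s * n%:R < (min_inversion (fun i => Z n i w))%:R).
Proof.
move=> n0; rewrite /S /scaled_min_inversion [X in _ < X]mulrC ltr_pdivlMr//.
by rewrite ltr0n.
Qed.

Let lower_exceptional (e : R) : 0 < e ->
  exists E : forall n, set (T n), [/\ forall n, measurable (E n),
    mass (P n) (E n) @[n --> \oo] --> 0 &
    forall n w, (0 < n)%N -> ~ E n w -> ~ off_tiles n w -> M - e < S n w].
Proof.
(* Concentration needs a nonnegative level; for negative [M - e] the claim follows from [S >= 0]. *)
move=> e0; have [Me|Me] := leP 0 (M - e); last first.
  exists (fun=> set0); split => //.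
    by under eq_fun do rewrite /mass measure0; exact: cvg_cst.
  move=> n w n0 _ _; apply: lt_le_trans Me _.
  by rewrite mulr_ge0// invr_ge0.
have [E [mE E0 hE]] := inversions_gt_whp mu_permuton Z_iid id_bnd Me e0.
exists E; split => // n w n0 nE nO; rewrite S_gt//.
apply: lt_min_inversion => // i; have [l hl] := on_tiles nO i.
apply: (hE n w n0 nE i); first exact: tile_unit_square hl.
rewrite subrK mulrC ler_wpM2l//.
apply: le_trans (inversion_mass_le mu_permuton mu_supp (tile_int_tile hl)).
exact: min_tiling_inversion_le.
Qed.

(** A small square at the bottom-left corner of a minimizing tile has positive mass, so it is
    eventually hit; a sample point in it has inversion mass close to [M]. *)
Let upper_exceptional (l0 : 'I_k) (e : R) : 0 < e ->
  exists E : forall n, set (T n), [/\ forall n, measurable (E n),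
    mass (P n) (E n) @[n --> \oo] --> 0 &
    forall n w, (0 < n)%N -> ~ E n w -> S n w < M + e].
Proof.
move=> e0.
have [l hl] := min_tiling_inversion_ge mu_permuton mu_supp l0.
have s0 := tile_side_gt0 t l.
have M0 : 0 <= M.
  apply: le_trans hl; apply: sumr_ge0 => m _; exact/ltW/tile_side_gt0.
have eps0 : 0 < e / 2 by lra.
have eps1 : e / 2 < M + e by lra.
have [E [mE E0 hE]] := inversions_lt_whp mu_permuton Z_iid id_bnd eps0 eps1.
(* Two coordinate distances of at most [e / 4] add at most [e / 2] to the inversion mass, leaving
   [e / 2] for concentration. *)
pose rho := Num.min (e / 4) (tile_side t l).
have rho0 : 0 < rho by rewrite lt_min s0 andbT; lra.
have rhoe : rho <= e / 4 by rewrite ge_min lexx.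
have rhos : rho <= tile_side t l by rewrite ge_min lexx orbT.
pose Q := [set w | tile_x t l < w.1 < tile_x t l + rho /\
                   tile_y t l < w.2 < tile_y t l + rho].
have mQ : measurable Q.
  by apply: measurableI; [exact: measurable_between_fst|exact: measurable_between_snd].
have Q0 : 0 < mass mu Q.
  by apply: (mass_open_box_gt0 f_density f_gt0 (l := l)); lra.
have Q1 : mass mu Q <= 1 by exact: mass_le1.
have mH n : measurable [set w | hits (Z n) Q w == finset.set0].
  exact: (measurable_hits (Z n) (pred1 finset.set0)).
exists (fun n => E n `|` [set w | hits (Z n) Q w == finset.set0]); split.
- by move=> n; exact: measurableU.
- apply: (@squeeze_cvgr _ _ _ _ (fun=> 0)
    (fun n => mass (P n) (E n) + (1 - mass mu Q) ^+ n)).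
  + apply: nearW => n; rewrite mass_ge0/= -(mass_hits0 (Z_iid n))//.
    by apply: le_massU => //; exact: measurableU.
  + exact: cvg_cst.
  + rewrite -[X in _ --> X]addr0; apply: cvgD => //; apply: cvg_expr.
    by rewrite ger0_norm; lra.
- move=> n w n0 /not_orP[nE /negP/some_hit[i hQ]].
  have wint : tile_int t l (Z n i w).
    by move: hQ => [? ?]; split; lra.
  rewrite S_lt//.
  apply: (@le_lt_trans _ _ #|point_inversions (fun j => Z n j w) i|%:R).
    by rewrite ler_nat; exact: min_inversion_le.
  apply: (hE n w n0 nE i); first exact: tile_unit_square wint.
  rewrite mulrC ler_wpM2r//.
  have := inverted_mass_le mu_permuton mu_supp false (tile_int_tile wint).
  move: hQ => [? ?]; rewrite /corner_x /corner_y; move: hl; rewrite -/M; lra.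
Qed.

Lemma cvg_mass_min_tiling (e : R) : (0 < k)%N -> 0 < e ->
  mass (P n) [set w | e < `|S n w - M|] @[n --> \oo] --> 0.
Proof.
move=> k0 e0; have [E1 [mE1 E10 h1]] := lower_exceptional e0.
have [E2 [mE2 E20 h2]] := upper_exceptional (Ordinal k0) e0.
have mS n : measurable [set w | e < `|S n w - M|].
  have mSn : measurable_fun [set: T n] (fun w => `|S n w - M|).
    apply: (measurableT_comp (@normr_measurable R setT)).
    apply: measurable_funB; last exact: measurable_cst.
    exact: (measurable_scaled_min_inversion n%:R^-1 (Z n)).
  rewrite (_ : [set w | _] = (fun w => `|S n w - M|) @^-1` `]e, +oo[); last first.
    by apply/seteqP; split => w /=; rewrite in_itv/= andbT.
  by rewrite -[X in measurable X]setTI; exact: mSn.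
apply: (@squeeze_cvgr _ _ _ _ (fun=> 0)
  (fun n => mass (P n) (E1 n) + mass (P n) (E2 n))).
- near=> n; rewrite mass_ge0/=.
  have n0 : (0 < n)%N by near: n; exact: nbhs_infty_gt.
  have m1 := measurableU _ _ (mE1 n) (measurable_off_tiles n).
  have hm1 := le_massU (P n) m1 (mE1 n) (measurable_off_tiles n) (@subset_refl _ _).
  rewrite mass_off_tiles addr0 in hm1.
  apply: le_trans (le_massU (P n) (mS n) m1 (mE2 n) _) _; last by rewrite lerD2r.
  move=> w /=; apply: contraPP => /not_orP[/not_orP[nE1 nO] nE2].
  apply/negP; rewrite -leNgt ler_norml.
  by have := h1 n w n0 nE1 nO; have := h2 n w n0 nE2; lra.
- exact: cvg_cst.
- by rewrite -[X in _ --> X]addr0; apply: cvgD.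
Unshelve. all: by end_near. Qed.

End Linear.
End Limits.

(** The left limit at [c] is 0 and the value is 1; this excludes the point [c] from the test points
    of convergence in distribution. *)
Lemma dirac_cdf_discontinuous (R : realType) (c : R) :
  ~ {for c, continuous (fun s : R => dirac c `]-oo, s]%classic : \bar R)}.
Proof.
move=> /cvg_at_left_filter h.
have h1 : dirac c `]-oo, s]%classic @[s --> c^'-] --> (0 : \bar R).
  apply: cvg_near_cst; near=> s.
  rewrite diracE memNset//= in_itv/=; apply/negP; rewrite -ltNge.
  by near: s; exact: nbhs_left_lt.
have e01 : (0 : \bar R) = dirac c `]-oo, c]%classic.
  by apply: cvg_unique h1 h; exact: ereal_hausdorff.
move: (congr1 fine e01); rewrite diracE mem_set/=; last by rewrite in_itv/= lexx.
by move/eqP; rewrite eq_sym oner_eq0.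
Unshelve. all: by end_near. Qed.

(** * From convergence of masses to the two modes of convergence *)

Section MassConvergence.
Context (R : realType) (d : nat -> measure_display)
  (T : forall n, measurableType (d n)) (P : forall n, probability (T n) R)
  (X : forall n, {RV P n >-> R}).
Arguments X : clear implicits.

Lemma cvg_cdf_mass (r l : R) :
  mass (P n) [set w | X n w <= r] @[n --> \oo] --> l ->
  cdf (X n) r @[n --> \oo] --> l%:E.
Proof.
move=> h; apply: cvg_EFin.
  by apply: nearW => n; rewrite fin_num_measure.
apply: cvg_trans h; apply: near_eq_cvg; apply: nearW => n /=.
by congr (fine (P n _)); apply/seteqP; split => w /=; rewrite in_itv.
Qed.

Variable c : R.
Hypothesis cvgX : forall e : R, 0 < e ->
  mass (P n) [set w | e < `|X n w - c|] @[n --> \oo] --> 0.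

Let measurable_dev e n : measurable [set w | e < `|X n w - c|].
Proof.
have mX : measurable_fun [set: T n] (fun w => `|X n w - c|).
  apply: (measurableT_comp (@normr_measurable R setT)).
  by apply: measurable_funB.
rewrite (_ : [set w | _] = (fun w => `|X n w - c|) @^-1` `]e, +oo[); last first.
  by apply/seteqP; split => w /=; rewrite in_itv/= andbT.
by rewrite -[X in measurable X]setTI; exact: mX.
Qed.

Lemma cvg_in_probability_mass : cvg_in_probability P X c.
Proof.
move=> e e0; apply: cvg_EFin; last exact: cvgX.
by apply: nearW => n; rewrite fin_num_measure.
Qed.

Lemma cvg_in_distribution_dirac : cvg_in_distribution P X (dirac c).
Proof.
have mle r n : measurable [set w | X n w <= r].
  rewrite (_ : [set w | _] = X n @^-1` `]-oo, r]); last first.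
    by apply/seteqP; split => w /=; rewrite in_itv.
  by rewrite -[X in measurable X]setTI; exact: measurable_funPT.
move=> r cr; have [rc|rc|rc] := ltgtP r c; last first.
- by move: cr; rewrite rc => /dirac_cdf_discontinuous.
- rewrite [X in _ --> X](_ : _ = 1%:E); last first.
    by rewrite /= diracE mem_set//= in_itv/= ltW.
  apply: cvg_cdf_mass.
  have e0 : 0 < (r - c) / 2 by rewrite divr_gt0// subr_gt0.
  apply: (@squeeze_cvgr _ _ _ _
    (fun n => 1 - mass (P n) [set w | (r - c) / 2 < `|X n w - c|]) (fun=> 1)).
  + apply: nearW => n; rewrite mass_le1// andbT -mass_setC//.
    apply: le_mass => //; first exact: measurableC.
    by move=> w /= /negP; rewrite -leNgt ler_norml; lra.
  + rewrite -[X in _ --> X]subr0; apply: cvgB; [exact: cvg_cst|exact: cvgX].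
  + exact: cvg_cst.
- rewrite [X in _ --> X](_ : _ = 0%:E); last first.
    by rewrite /= diracE memNset//= in_itv/=; apply/negP; rewrite -ltNge.
  apply: cvg_cdf_mass.
  (* Half the gap, because the deviation event is a strict inequality while [X n w <= r] only gives
     a deviation of at least [c - r]. *)
  have e0 : 0 < (c - r) / 2 by rewrite divr_gt0// subr_gt0.
  apply: (@squeeze_cvgr _ _ _ _ (fun=> 0)
    (fun n => mass (P n) [set w | (c - r) / 2 < `|X n w - c|])).
  + apply: nearW => n; rewrite mass_ge0/=; apply: le_mass => // w /= h.
    by rewrite distrC ltr_normr; lra.
  + exact: cvg_cst.
  + exact: cvgX.
Qed.

End MassConvergence.

Theorem corollary1p4 (R : realType) (k : nat) (t : tiling R k)
    (mu : probability (R * R)%type R) (f : 'I_k -> R * R -> R)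
    (mu_permuton : is_permuton mu)
    (mu_supp : mu (\bigcup_l tile t l) = 1%E)
    (f_density : forall l, is_density_on mu (tile t l) (f l))
    (f_gt0 : forall l z, tile t l z -> 0 < f l z)
    (f_pwc : forall l, piecewise_continuous_on (tile t l) (f l))
    (f_bl : forall l, continuous_at_within (tile t l) (bottom_left t l) (f l))
    (f_tr : forall l, continuous_at_within (tile t l) (top_right t l) (f l))
    (d : nat -> measure_display) (T : forall n, measurableType (d n))
    (P : forall n, probability (T n) R)
    (Z : forall n, 'I_n -> {RV P n >-> (R * R)%type})
    (Z_iid : forall n, iid (P n) (Z n) mu) :
  (splittings t <> finset.set0 ->
    exists nu : probability R R,
      is_rayleigh nu 2
        (\sum_(l in splittings t)
          (f l (bottom_left t l) + f l (top_right t l)) / 2) /\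
      cvg_in_distribution P
        (fun n => scaled_min_inversion (Num.sqrt n%:R)^-1 (Z n)) nu) /\
  (splittings t = finset.set0 ->
    cvg_in_distribution P
      (fun n => scaled_min_inversion n%:R^-1 (Z n))
      (dirac (min_tiling_inversion t)) /\
    cvg_in_probability P
      (fun n => scaled_min_inversion n%:R^-1 (Z n))
      (min_tiling_inversion t)).
Proof.
(* The abscissa 0 is covered, so there is at least one tile. *)
have k0 : (0 < k)%N.
  have [|l _ _] := @tile_x_cover _ _ t 0; first by rewrite /= in_itv/= lexx ler01.
  exact: leq_ltn_trans (leq0n l) (ltn_ord l).
split=> [/eqP/set0Pn[l0 l0D]|_].
  set B0 := \sum_(l in _) _.
  have ge0 l b : 0 < f l (corner t l b) by apply: f_gt0; exact: tile_corner.
  (* A single splitting already contributes a positive term, and positivity gives the existence of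
     the Rayleigh law. *)
  have B0_gt0 : 0 < B0.
    rewrite /B0 (bigD1 l0)//= ltr_wpDr//.
      apply: sumr_ge0 => l _; rewrite divr_ge0// addr_ge0// ltW//.
        exact: (ge0 l false).
      exact: (ge0 l true).
    by rewrite divr_gt0// addr_gt0//; [exact: (ge0 l0 false)|exact: (ge0 l0 true)].
  have [nu nuR] := rayleigh_exists B0_gt0.
  exists nu; split=> // r _; rewrite (rayleigh_cdf r B0_gt0 nuR).
  apply: cvg_cdf_mass.
  exact: (cvg_cdf_rayleigh mu_permuton mu_supp f_density f_gt0 f_bl f_tr Z_iid).
have h e : 0 < e -> mass (P n) [set w | e <
    `|scaled_min_inversion n%:R^-1 (Z n) w - min_tiling_inversion t|]
    @[n --> \oo] --> 0.
  exact: (cvg_mass_min_tiling mu_permuton mu_supp f_density f_gt0 Z_iid k0).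
by split; [exact: cvg_in_distribution_dirac|exact: cvg_in_probability_mass].
Qed.
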